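(* Let $P$ be a simplicial poset with vertices $x_1,\dots,x_n$, and let $\alpha=(\alpha_1,\dots,\alpha_n)\in\mathbb{Z}^n$. Then for every $i$ $$H_{\mathfrak{m}}^i(A_P)_\alpha\cong\bigoplus_{\substack{w\in P\\ \mathrm{supp}(w)=\{j:\alpha_j\neq0\}}}H^{i-1}(P,\mathrm{cost}_P(w))$$ if $\alpha\in\mathbb{Z}_{\le0}^n$, and $H_{\mathfrak{m}}^i(A_P)_\alpha=0$ otherwise. Moreover, these isomorphisms (for all $\alpha\in\mathbb{Z}^n_{\le 0}$) can be chosen so that under them the $A$-module structure of $H_{\mathfrak{m}}^i(A_P)$ is given as follows. Let $\alpha\in\mathbb{Z}^n_{\le0}$, $1\le j\le n$, and $\gamma=\alpha+\deg(x_j)$. (1) If $\alpha_j<-1$, then $\cdot x_j:H_{\mathfrak{m}}^i(A_P)_\alpha\to H_{\mathfrak{m}}^i(A_P)_\gamma$ corresponds to the direct sum of identity maps $$\bigoplus_{\mathrm{supp}(w)=\mathrm{supp}(\alpha)}H^{i-1}(P,\mathrm{cost}_P(w))\to\bigoplus_{\mathrm{supp}(w)=\mathrm{supp}(\gamma)}H^{i-1}(P,\mathrm{cost}_P(w))$$ (note $\mathrm{supp}(\alpha)=\mathrm{supp}(\gamma)$ here). (2) If $\alpha_j=-1$, then $\cdot x_j$ corresponds to the map $$\bigoplus_{\mathrm{supp}(w)=\mathrm{supp}(\alpha)}H^{i-1}(P,\mathrm{cost}_P(w))\to\bigoplus_{\mathrm{supp}(z)=\mathrm{supp}(\gamma)}H^{i-1}(P,\mathrm{cost}_P(z))$$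 whose restriction to the summand indexed by $w$ is the map into the summand indexed by $z=w\smallsetminus\{x_j\}$ induced by the inclusion of pairs $(P,\mathrm{cost}_P(w\smallsetminus\{x_j\}))\to(P,\mathrm{cost}_P(w))$. (3) If $\alpha_j\ge0$, then $\cdot x_j$ is the zero map.
   Context: Posets. A simplicial poset is a finite poset $(P,\preceq)$ with a least element $\hat 0$ such that every interval $[\hat 0,y]$, $y\in P$, is a Boolean lattice. The rank of $y$ is the maximal length of a chain from $\hat 0$ to $y$; elements of rank $1$ are called vertices and are labeled $x_1,\dots,x_n$. For $y\in P$, $\mathrm{supp}(y)=\{i:x_i\preceq y\}$; for $\alpha\in\mathbb{Z}^n$, $\mathrm{supp}(\alpha)=\{i:\alpha_i\ne0\}$. For $j\in\mathrm{supp}(w)$, $w\smallsetminus\{x_j\}$ is the unique element $w'\preceq w$ with $\mathrm{supp}(w')=\mathrm{supp}(w)\smallsetminus\{j\}$. The contrastar is $\mathrm{cost}_P(y)=\{w\in P:y\not\preceq w\}$, an order ideal of $P$. $\mathcal{M}(w,y)$ is the set of minimal upper bounds of $w$ and $y$ in $P$. Cohomology. Let $\Bbbk$ be a fixed infinite field. $\widetilde C^i(P)$ is the $\Bbbk$-vector space with basis the elements of $P$ of rank $i+1$. An orientation is a partial order $\mathcal{O}$ on $\{1,\dots,n\}$ restricting to a total order on the support of every element of $P$; fix one. The coboundary is $\delta(y)=\sum_{j\notin\mathrm{supp}(y)}(-1)^{u_j}\sum_{z\in\mathcal{M}(x_j,y)}z$, with $u_j=|\{k\in\mathrm{supp}(y):j<_{\mathcal{O}}k\}|$.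 For an order ideal $Q\subseteq P$, the relative cochain space is $C^i(P,Q)=\widetilde C^i(P)/\widetilde C^i(Q)$, with basis the elements of $P\smallsetminus Q$ of rank $i+1$, with coboundary given by the same formula $\delta$ (which preserves the span of $P\smallsetminus Q$); its cohomology is $H^i(P,Q)$. When $Q=\emptyset$ (e.g. $Q=\mathrm{cost}_P(\hat 0)$), this reads $H^i(P,\emptyset)=\widetilde H^i(P)$, the cohomology of $(\widetilde C^\bullet(P),\delta)$. For order ideals $Q'\subseteq Q$, the inclusion of pairs $(P,Q')\to(P,Q)$ induces the map $H^i(P,Q)\to H^i(P,Q')$ given on cochains by $y\mapsto y$ for $y\in P\smallsetminus Q$. Algebra. $A=\Bbbk[x_1,\dots,x_n]$, $\mathfrak{m}=(x_1,\dots,x_n)$, and $H^i_{\mathfrak{m}}$ denotes local cohomology with support in $\mathfrak{m}$. The face ring is $A_P=\Bbbk[y:y\in P]/I_P$, where $I_P$ is generated by $\hat 0-1$ and, for each pair $w,y\in P$, by $wy$ if $\mathcal{M}(w,y)=\emptyset$ and by $wy-(w\wedge y)\sum_{z\in\mathcal{M}(w,y)}z$ if $\mathcal{M}(w,y)\neq\emptyset$. $A$ is $\mathbb{Z}^n$-graded by $\deg(x_i)=\mathbf{e}_i$, and $A_P$ by $\deg(y)=\sum_{i\in\mathrm{supp}(y)}\mathbf{e}_i$; $A_P$ is a $\mathbb{Z}^n$-graded $A$-module, so $H^i_{\mathfrak{m}}(A_P)$ is $\mathbb{Z}^n$-graded, and the subscript $\alpha$ denotes the degree-$\alpha$ piece.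 *)

(* Defs.v *)
From HB Require Import structures.
From mathcomp Require Import all_boot all_order all_algebra.
From mathcomp Require Import boolp.
From mathcomp Require Import generic_quotient ring_quotient.
From mathcomp Require Import zify.
From mathcomp.multinomials Require Import mpoly.

Set Implicit Arguments.
Unset Strict Implicit.
Unset Printing Implicit Defensive.

Import Order.TTheory GRing.Theory.

Local Open Scope ring_scope.
Local Open Scope quotient_scope.

Section QuotientModule.
Variables (R : nzRingType) (V : lmodType R) (S : submodClosed V).

Definition submod_pred : {pred V} := fun v => v \in S.

Fact submod_pred_zmod_closed : zmod_closed submod_pred.
Proof.
split=> [|u v uS vS]; first exact: (rpred0 S).
by rewrite unfold_in rpredD // -scaleN1r rpredZ.
Qed.

HB.instance Definition _ :=
  GRing.isZmodClosed.Build V submod_pred submod_pred_zmod_closed.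

Definition quot_mod := {ideal_quot submod_pred}.

HB.instance Definition _ := GRing.Zmodule.on quot_mod.

Definition quot_pi (v : V) : quot_mod := \pi_({ideal_quot submod_pred}) v.

Definition quot_repr (h : quot_mod) : V := repr (h : {ideal_quot submod_pred}).

Lemma quot_reprK : cancel quot_repr quot_pi.
Proof. by move=> h; rewrite /quot_pi /quot_repr reprK. Qed.

Lemma quot_pi_eq u v : (quot_pi u == quot_pi v) = (u - v \in S).
Proof. by rewrite /quot_pi -(Quotient.idealrBE submod_pred). Qed.

Lemma quot_piD : {morph quot_pi : u v / u + v}.
Proof. by move=> u v; rewrite /quot_pi raddfD. Qed.

Definition quot_scale (a : R) (h : quot_mod) := quot_pi (a *: quot_repr h).

Lemma quot_piZ a v : quot_pi (a *: v) = quot_scale a (quot_pi v).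
Proof.
apply/eqP; rewrite quot_pi_eq -scalerBr rpredZ // -quot_pi_eq.
by rewrite quot_reprK.
Qed.

Fact quot_scaleA a b h : quot_scale a (quot_scale b h) = quot_scale (a * b) h.
Proof. by rewrite -[h]quot_reprK -!quot_piZ scalerA. Qed.

Fact quot_scale1 : left_id 1 quot_scale.
Proof. by move=> h; rewrite -[h]quot_reprK -quot_piZ scale1r. Qed.

Fact quot_scaleDr : right_distributive quot_scale +%R.
Proof.
move=> a g h; rewrite -[g]quot_reprK -[h]quot_reprK -quot_piD -!quot_piZ.
by rewrite -quot_piD scalerDr.
Qed.

Fact quot_scaleDl h : {morph quot_scale^~ h : a b / a + b}.
Proof. by move=> a b; rewrite -[h]quot_reprK -!quot_piZ -quot_piD scalerDl. Qed.

HB.instance Definition _ := GRing.Zmodule_isLmodule.Build R quot_mod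
  quot_scaleA quot_scale1 quot_scaleDr quot_scaleDl.

Fact quot_pi_linear : linear quot_pi.
Proof. by move=> a u v; rewrite quot_piD quot_piZ. Qed.

HB.instance Definition _ :=
  GRing.isLinear.Build R V quot_mod *:%R quot_pi quot_pi_linear.

End QuotientModule.

Section ProductModule.
Variables (R : nzRingType) (I : Type) (V : I -> lmodType R).

Definition prod_mod := forall i, V i.

HB.instance Definition _ := Choice.on prod_mod.

Implicit Types u v w : prod_mod.

Definition prod_add u v : prod_mod := fun i => u i + v i.
Definition prod_opp u : prod_mod := fun i => - u i.
Definition prod_zero : prod_mod := fun i => 0.
Definition prod_scale (a : R) u : prod_mod := fun i => a *: u i.

Fact prod_addA : associative prod_add.
Proof. by move=> u v w; apply/functional_extensionality_dep => i; rewrite /prod_add addrA. Qed.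
Fact prod_addC : commutative prod_add.
Proof. by move=> u v; apply/functional_extensionality_dep => i; rewrite /prod_add addrC. Qed.
Fact prod_add0 : left_id prod_zero prod_add.
Proof. by move=> u; apply/functional_extensionality_dep => i; rewrite /prod_add add0r. Qed.
Fact prod_addN : left_inverse prod_zero prod_opp prod_add.
Proof. by move=> u; apply/functional_extensionality_dep => i; rewrite /prod_add addNr. Qed.

HB.instance Definition _ :=
  GRing.isZmodule.Build prod_mod prod_addA prod_addC prod_add0 prod_addN.

Fact prod_scaleA a b v : prod_scale a (prod_scale b v) = prod_scale (a * b) v.
Proof. by apply/functional_extensionality_dep => i; rewrite /prod_scale scalerA. Qed.
Fact prod_scale1 : left_id 1 prod_scale.
Proof. by move=> v; apply/functional_extensionality_dep => i; rewrite /prod_scale scale1r. Qed.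
Fact prod_scaleDr : right_distributive prod_scale +%R.
Proof. by move=> a u v; apply/functional_extensionality_dep => i; rewrite /prod_scale scalerDr. Qed.
Fact prod_scaleDl v : {morph prod_scale^~ v : a b / a + b}.
Proof. by move=> a b; apply/functional_extensionality_dep => i; rewrite /prod_scale scalerDl. Qed.

HB.instance Definition _ := GRing.Zmodule_isLmodule.Build R prod_mod
  prod_scaleA prod_scale1 prod_scaleDr prod_scaleDl.

Lemma prod_modP a u v i : (a *: u + v) i = a *: u i + v i.
Proof. by []. Qed.

End ProductModule.

Lemma scaler_swap (A : comNzRingType) (M : lmodType A) a b (m : M) :
  a *: (b *: m) = b *: (a *: m).
Proof. by rewrite !scalerA mulrC. Qed.

Section Localization.
Variables (A : comNzRingType) (M : lmodType A) (f : A).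

(* (m, k) stands for the fraction m / f ^+ k *)
Definition frac_eq (p q : M * nat) : bool :=
  `[< exists l, f ^+ (l + q.2) *: p.1 = f ^+ (l + p.2) *: q.1 >].

Fact frac_eq_equiv : equiv_class_of frac_eq.
Proof.
split=> [p|p q|q p r].
- by apply/asboolP; exists 0%N.
- by apply: asbool_equiv_eq; split=> -[l ll]; exists l; rewrite ll.
move=> /asboolP[l pq] /asboolP[m qr]; apply/asboolP; exists (l + m + q.2)%N.
have -> : (l + m + q.2 + r.2 = (m + r.2) + (l + q.2))%N by lia.
rewrite exprD -scalerA pq scalerA -exprD.
have -> : (m + r.2 + (l + p.2) = (l + p.2) + (m + r.2))%N by lia.
rewrite exprD -scalerA qr scalerA -exprD.
by congr (f ^+ _ *: _); lia.
Qed.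

Canonical frac_eq_rel := EquivRelPack frac_eq_equiv.

Definition loc := {eq_quot frac_eq}.

HB.instance Definition _ := Choice.on loc.

Definition frac (m : M) (k : nat) : loc := \pi_({eq_quot frac_eq}) (m, k).
Definition numer (z : loc) : M := (repr (z : {eq_quot frac_eq})).1.
Definition denom (z : loc) : nat := (repr (z : {eq_quot frac_eq})).2.

Lemma fracK z : frac (numer z) (denom z) = z.
Proof. by rewrite /frac /numer /denom -surjective_pairing reprK. Qed.

Lemma fracP m k m' k' : frac m k = frac m' k' <->
  exists l, f ^+ (l + k') *: m = f ^+ (l + k) *: m'.
Proof.
split=> [/eqP|mm]; first by rewrite /frac piE => /asboolP.
by apply/eqP; rewrite /frac piE; apply/asboolP.
Qed.

Lemma numerP m k :
  exists l, f ^+ (l + denom (frac m k)) *: m = f ^+ (l + k) *: numer (frac m k).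
Proof. by apply/fracP; rewrite fracK. Qed.

Definition loc_add (y z : loc) : loc :=
  frac (f ^+ denom z *: numer y + f ^+ denom y *: numer z) (denom y + denom z).
Definition loc_opp (z : loc) : loc := frac (- numer z) (denom z).
Definition loc_zero : loc := frac 0 0.
Definition loc_scale (a : A) (z : loc) : loc := frac (a *: numer z) (denom z).

Lemma loc_addE m k m' k' : loc_add (frac m k) (frac m' k') =
  frac (f ^+ k' *: m + f ^+ k *: m') (k + k').
Proof.
have [l ll] := numerP m k; have [l' ll'] := numerP m' k'.
set d := denom _ in ll *; set d' := denom _ in ll' *.
apply/fracP; exists (l + l')%N; rewrite !scalerDr !scalerA -!exprD.
congr (_ + _).
  have -> : (l + l' + (k + k') + d' = (l' + k' + d') + (l + k))%N by lia.
  rewrite exprD -scalerA -ll scalerA -exprD; congr (f ^+ _ *: _); rewrite -/d -/d'; lia.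
have -> : (l + l' + (k + k') + d = (l + k + d) + (l' + k'))%N by lia.
rewrite exprD -scalerA -ll' scalerA -exprD; congr (f ^+ _ *: _); rewrite -/d -/d'; lia.
Qed.

Lemma loc_oppE m k : loc_opp (frac m k) = frac (- m) k.
Proof.
by have [l ll] := numerP m k; apply/fracP; exists l; rewrite !scalerN ll.
Qed.

Lemma loc_scaleE a m k : loc_scale a (frac m k) = frac (a *: m) k.
Proof.
have [l ll] := numerP m k; apply/fracP; exists l.
by rewrite !scalerA ![_ * a]mulrC -!scalerA ll.
Qed.

Lemma eq_frac m m' k k' : m = m' -> k = k' -> frac m k = frac m' k'.
Proof. by move=> -> ->. Qed.

Fact loc_addA : associative loc_add.
Proof.
move=> x y z; rewrite -[x]fracK -[y]fracK -[z]fracK !loc_addE addnA.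
apply: eq_frac => //; rewrite !scalerDr !scalerA -!exprD addrA.
by congr (_ *: _ + _ *: _ + _ *: _); congr (_ ^+ _); lia.
Qed.
Fact loc_addC : commutative loc_add.
Proof. by move=> x y; rewrite /loc_add addrC addnC. Qed.
Fact loc_add0 : left_id loc_zero loc_add.
Proof.
by move=> x; rewrite -[x]fracK loc_addE scaler0 add0r expr0 scale1r.
Qed.
Fact loc_addN : left_inverse loc_zero loc_opp loc_add.
Proof.
move=> x; rewrite -[x]fracK loc_oppE loc_addE scalerN addNr.
by apply/fracP; exists 0%N; rewrite !scaler0.
Qed.

HB.instance Definition _ :=
  GRing.isZmodule.Build loc loc_addA loc_addC loc_add0 loc_addN.

Fact loc_scaleA a b z : loc_scale a (loc_scale b z) = loc_scale (a * b) z.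
Proof. by rewrite -[z]fracK !loc_scaleE scalerA. Qed.
Fact loc_scale1 : left_id 1 loc_scale.
Proof. by move=> z; rewrite -[z]fracK !loc_scaleE scale1r. Qed.
Fact loc_scaleDr : right_distributive loc_scale +%R.
Proof.
have scD a y z : loc_scale a (loc_add y z) = loc_add (loc_scale a y) (loc_scale a z).
  rewrite -[y]fracK -[z]fracK loc_addE !loc_scaleE loc_addE.
  by apply: eq_frac; rewrite // scalerDr !scalerA ![a * _]mulrC.
exact: scD.
Qed.
Fact loc_scaleDl z : {morph loc_scale^~ z : a b / a + b}.
Proof.
have scD a b : loc_scale (a + b) z = loc_add (loc_scale a z) (loc_scale b z).
  rewrite -[z]fracK !loc_scaleE loc_addE -scalerDr -scalerDl.
  by apply/fracP; exists 0%N; rewrite !add0n exprD !scalerA ?mulrA.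
exact: scD.
Qed.

HB.instance Definition _ := GRing.Zmodule_isLmodule.Build A loc
  loc_scaleA loc_scale1 loc_scaleDr loc_scaleDl.

Lemma fracD m k m' k' :
  frac m k + frac m' k' = frac (f ^+ k' *: m + f ^+ k *: m') (k + k').
Proof. exact: loc_addE. Qed.

Lemma fracZ a m k : a *: frac m k = frac (a *: m) k.
Proof. exact: loc_scaleE. Qed.

End Localization.

Section LocalizationMap.
Variables (A : comNzRingType) (M : lmodType A) (f g e : A).

(* For g = f * e, the canonical map M_f -> M_g, m / f ^+ k |-> e ^+ k m / g ^+ k *)
Definition loc_map (z : loc M f) : loc M g :=
  frac g (e ^+ denom z *: numer z) (denom z).

Hypothesis gE : g = f * e.

Lemma loc_map_frac m k : loc_map (frac f m k) = frac g (e ^+ k *: m) k.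
Proof.
have [l ll] := numerP f m k; rewrite /loc_map.
set z := frac f m k in ll *; set d := denom z in ll *.
apply/fracP; exists l; rewrite !scalerA gE !exprMn.
have -> : f ^+ (l + k) * e ^+ (l + k) * e ^+ d = e ^+ (l + k + d) * f ^+ (l + k).
  by rewrite -mulrA -exprD mulrC.
have -> : f ^+ (l + d) * e ^+ (l + d) * e ^+ k = e ^+ (l + k + d) * f ^+ (l + d).
  by rewrite -mulrA -exprD mulrC addnAC.
by rewrite -!scalerA ll.
Qed.

Lemma loc_map_linear : linear loc_map.
Proof.
move=> a y z; rewrite -[y]fracK -[z]fracK fracZ fracD !loc_map_frac fracZ fracD.
apply: eq_frac => //; rewrite scalerDr !scalerA gE !exprMn exprD.
congr (_ *: _ + _ *: _); rewrite -!mulrA.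
  by rewrite mulrC -!mulrA mulrCA.
by rewrite mulrA mulrC.
Qed.

End LocalizationMap.

Section Cohomology.
Variables (R : nzRingType) (U V W : lmodType R).
Variables (f : {linear U -> V}) (g : {linear V -> W}).

Definition ker_pred : {pred V} := fun v => g v == 0.

Lemma mem_ker v : (v \in ker_pred) = (g v == 0).
Proof. by []. Qed.

Fact ker_pred_submod_closed : submod_closed ker_pred.
Proof.
split=> [|a u v /eqP gu /eqP gv]; rewrite unfold_in ?linear0 //.
by rewrite linearP gu gv scaler0 addr0.
Qed.

HB.instance Definition _ :=
  GRing.isSubmodClosed.Build R V ker_pred ker_pred_submod_closed.

Definition cocycle := {v : V | v \in ker_pred}.

HB.instance Definition _ := SubChoice.on cocycle.
HB.instance Definition _ := [SubChoice_isSubLmodule of cocycle by <:].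

Definition coboundary_pred : {pred cocycle} :=
  fun z => `[< exists u, f u = val z >].

Fact coboundary_pred_submod_closed : submod_closed coboundary_pred.
Proof.
split=> [|a y z /asboolP[u fu] /asboolP[v fv]]; apply/asboolP.
  by exists 0; rewrite !linear0.
by exists (a *: u + v); rewrite !linearP fu fv.
Qed.

HB.instance Definition _ := GRing.isSubmodClosed.Build R cocycle
  coboundary_pred coboundary_pred_submod_closed.

(* ker g / (im f :&: ker g), i.e. ker g / im f when g \o f = 0 *)
Definition cohomology := quot_mod coboundary_pred.

HB.instance Definition _ := GRing.Lmodule.on cohomology.

(* The class of v if g v = 0, and 0 otherwise *)
Definition coclass (v : V) : cohomology :=
  oapp (fun z : cocycle => quot_pi coboundary_pred z) 0 (insub v).

Lemma coclassE (z : cocycle) : coclass (val z) = quot_pi coboundary_pred z.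
Proof. by rewrite /coclass valK. Qed.

Lemma coclass_eq u v : g u = 0 -> g v = 0 ->
  coclass u = coclass v <-> exists w, f w = u - v.
Proof.
move=> /eqP gu /eqP gv.
rewrite -[u](SubK cocycle gu) -[v](SubK cocycle gv) !coclassE.
split=> [/eqP|[w fw]]; last by apply/eqP; rewrite quot_pi_eq; apply/asboolP; exists w.
by rewrite quot_pi_eq => /asboolP.
Qed.

Definition representative (h : cohomology) : V := val (quot_repr h).

Lemma representativeP h :
  g (representative h) = 0 /\ coclass (representative h) = h.
Proof.
split; first by apply/eqP; exact: (valP (quot_repr h)).
by rewrite coclassE quot_reprK.
Qed.

End Cohomology.

Section CohomologyMap.
Variables (R : nzRingType) (U V W U' V' W' : lmodType R).
Variables (f : {linear U -> V}) (g : {linear V -> W}).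
Variables (f' : {linear U' -> V'}) (g' : {linear V' -> W'}).
Variable t : V -> V'.

(* The map induced by a morphism t of complexes, see [cohomology_map_class] *)
Definition cohomology_map (h : cohomology f g) : cohomology f' g' :=
  coclass f' g' (t (representative h)).

Lemma cohomology_map_class v : {morph t : x y / x - y} ->
    (forall u, g u = 0 -> g' (t u) = 0) ->
    (forall u, exists u', t (f u) = f' u') ->
  g v = 0 -> cohomology_map (coclass f g v) = coclass f' g' (t v).
Proof.
move=> tB tZ tf gv; have [gr rv] := representativeP (coclass f g v).
apply/coclass_eq; [exact: tZ | exact: tZ |].
have [u fu] : exists u, f u = representative (coclass f g v) - v.
  by apply/(coclass_eq f gr gv).
by have [u' u'E] := tf u; exists u'; rewrite -u'E fu tB.
Qed.

End CohomologyMap.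

Section LocalCohomology.
Variables (K : fieldType) (n : nat) (M : lmodType {mpoly K[n]}).

Definition xprod (F : {set 'I_n}) : {mpoly K[n]} := \prod_(j in F) 'X_j.

Definition face_idx (i : int) := {F : {set 'I_n} | #|F|%:Z == i}.

Definition cech (i : int) : lmodType {mpoly K[n]} :=
  prod_mod (fun F : face_idx i => loc M (xprod (val F))).

Definition cech_sign (F G : {set 'I_n}) : nat :=
  #|[set b in F | [exists a in G :\: F, (b < a)%N]]|.

(* The differential of the Cech complex is [cech_d i (i + 1)]; the target degree
   is a separate parameter so that [cech_d (i - 1) i] has target [cech i]. *)
Definition cech_d (i j : int) (c : cech i) : cech j := fun G : face_idx j =>
  \sum_(F : face_idx i | val F \subset val G) (-1) ^+ cech_sign (val F) (val G)
    *: loc_map (xprod (val G)) (xprod (val G :\: val F)) (c F).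

Fact cech_d_linear i j : linear (@cech_d i j).
Proof.
move=> a b c; apply/functional_extensionality_dep => G.
rewrite [RHS]prod_modP scaler_sumr -big_split /=; apply: eq_bigr => F FG.
rewrite prod_modP loc_map_linear; first by rewrite scalerDr [in LHS]scaler_swap.
rewrite /xprod [LHS](big_setID (val F)) /=; congr (_ * _).
by rewrite (setIidPr FG).
Qed.

HB.instance Definition _ i j := GRing.isLinear.Build {mpoly K[n]}
  (cech i) (cech j) *:%R (@cech_d i j) (@cech_d_linear i j).

(* Local cohomology with support in (x_1, ..., x_n), as the cohomology of the
   extended Cech complex 0 -> M -> \bigoplus_j M_(x_j) -> ... -> M_(x_1 ... x_n) *)
Definition local_cohomology (i : int) : lmodType {mpoly K[n]} :=
  cohomology (@cech_d (i - 1) i) (@cech_d i (i + 1)).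

(* The pieces of degree alpha, when [Mdeg alpha] is the one of M *)
Variable Mdeg : {ffun 'I_n -> int} -> M -> Prop.

Definition loc_deg (F : {set 'I_n}) (alpha : {ffun 'I_n -> int})
    (z : loc M (xprod F)) : Prop :=
  exists k m, z = frac (xprod F) m k
    /\ Mdeg [ffun j => alpha j + (k * (j \in F))%N%:Z] m.

Definition cech_deg i (alpha : {ffun 'I_n -> int}) (c : cech i) : Prop :=
  forall F, loc_deg alpha (c F).

Definition local_cohomology_deg i (alpha : {ffun 'I_n -> int})
    (h : local_cohomology i) : Prop :=
  exists2 c, cech_deg alpha c & @cech_d i (i + 1) c = 0 /\ h = coclass _ _ c.

End LocalCohomology.

Section Posets.
Variables (d : Order.disp_t) (P : finBPOrderType d).
Implicit Types w y z : P.

Definition boolean_interval y : Prop := exists r (f : P -> {set 'I_r}),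
  (forall w z, (w <= y)%O -> (z <= y)%O -> (w <= z)%O = (f w \subset f z)) /\
  (forall S, exists2 w, (w <= y)%O & f w = S).

Definition simplicial_poset : Prop := forall y, boolean_interval y.

Definition chain_to y (C : {set P}) : bool :=
  [&& \bot%O \in C, y \in C, [forall w in C, (w <= y)%O]
    & [forall w in C, forall z in C, (w >=< z)%O]].

Definition rank y : nat := \max_(C : {set P} | chain_to y C) #|C|.-1.

Definition upper_bound w y z : bool := (w <= z)%O && (y <= z)%O.

Definition min_upper_bounds w y : {set P} :=
  [set z | upper_bound w y z
         & [forall u, upper_bound w y u && (u <= z)%O ==> (u == z)]].

(* The greatest lower bound of w and y, when it exists; in a simplicial poset it
   exists as soon as w and y have a common upper bound. *)
Definition wedge w y : P :=
  odflt \bot%O [pick m | [&& (m <= w)%O, (m <= y)%O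
                           & [forall u, (u <= w)%O && (u <= y)%O ==> (u <= m)%O]]].

Definition contrastar y : {set P} := [set w | ~~ (y <= w)%O].

Variables (n : nat) (x : 'I_n -> P).

Definition vertex_labeling : Prop :=
  injective x /\ forall y, rank y = 1%N <-> exists j, x j = y.

Definition supp y : {set 'I_n} := [set j | (x j <= y)%O].

Definition remove_vertex w (j : 'I_n) : P :=
  odflt w [pick w' | (w' <= w)%O && (supp w' == supp w :\ j)].

Definition orientation (O : rel 'I_n) : Prop :=
  [/\ reflexive O, antisymmetric O, transitive O
    & forall y, {in supp y &, total O}].

End Posets.

Definition degree_supp (n : nat) (alpha : {ffun 'I_n -> int}) : {set 'I_n} :=
  [set j | alpha j != 0].

Definition unit_degree (n : nat) (j : 'I_n) : {ffun 'I_n -> int} :=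
  [ffun k => (k == j)%:Z].

Definition nonpositive (n : nat) (alpha : {ffun 'I_n -> int}) : bool :=
  [forall j, alpha j <= 0].

(* phi restricts to a K-linear isomorphism from the piece H_alpha of H onto D;
   its values outside of H_alpha are irrelevant. *)
Definition restricts_to_iso (K : fieldType) (n : nat) (H : lmodType {mpoly K[n]})
    (D : lmodType K) (H_alpha : H -> Prop) (phi : H -> D) : Prop :=
  [/\ forall (a : K) h h', H_alpha h -> H_alpha h' ->
        phi (a%:MP *: h + h') = a *: phi h + phi h',
      forall h, H_alpha h -> phi h = 0 -> h = 0
    & forall u, exists2 h, H_alpha h & phi h = u].

Section FaceRing.
Variables (K : fieldType) (d : Order.disp_t) (P : finBPOrderType d).

Definition poset_var (y : P) : {mpoly K[#|P|]} := 'X_(enum_rank y).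

(* When there is no upper bound the sum is empty. *)
Definition face_relation (t : option (P * P)) : {mpoly K[#|P|]} :=
  if t is Some (w, y)
  then poset_var w * poset_var y
       - poset_var (wedge w y) * \sum_(z in min_upper_bounds w y) poset_var z
  else poset_var \bot%O - 1.

Definition face_ideal : {pred {mpoly K[#|P|]}} := fun p =>
  `[< exists a : {ffun option (P * P) -> {mpoly K[#|P|]}},
        p = \sum_t a t * face_relation t >].

Fact face_ideal_idealr_closed : idealr_closed face_ideal.
Proof.
pose v (i : 'I_#|P|) : K := (enum_val i == \bot%O :> P)%:R.
have vX y : (poset_var y).@[v] = (y == \bot%O)%:R by rewrite mevalXU /v enum_rankK.
have vR t : (face_relation t).@[v] = 0.
  case: t => [[w y]|] /=; last by rewrite mevalB meval1 vX eqxx subrr.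
  rewrite mevalB !mevalM !vX raddf_sum /=.
  have [/andP[/eqP-> /eqP->]|wy] := boolP ((w == \bot%O) && (y == \bot%O)).
    rewrite eqxx (_ : wedge _ _ = \bot%O) ?eqxx; last first.
      rewrite /wedge; case: pickP => //= m /andP[+ _].
      by rewrite lex0 => /eqP.
    rewrite (big_pred1 \bot%O) ?vX ?eqxx ?mulr1 ?subrr // => z.
    rewrite !inE /upper_bound !le0x /=.
    apply/forallP/eqP => [/(_ \bot%O)|-> u].
      by rewrite !le0x /= => /eqP.
    by rewrite !le0x /= lex0; apply/implyP.
  rewrite -natrM mulnb (negPf wy) big1 ?mulr0 ?subrr // => z.
  rewrite inE => /andP[/andP[wz yz] _]; rewrite vX; case: eqP => // z0.
  by move: wz yz wy; rewrite z0 !lex0 => -> ->.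
split=> [||a p q /asboolP[b ->] /asboolP[c ->]].
- by apply/asboolP; exists 0; rewrite big1 // => t _; rewrite ffunE mul0r.
- apply/negP => /asboolP[a] /(congr1 (meval v)).
  rewrite meval1 raddf_sum big1 /= => [/eqP|t _]; first by rewrite oner_eq0.
  by rewrite mevalM vR mulr0.
apply/asboolP; exists [ffun t => a * b t + c t].
rewrite mulr_sumr -big_split; apply: eq_bigr => t _.
by rewrite ffunE mulrDl mulrA.
Qed.

HB.instance Definition _ :=
  isIdealr.Build {mpoly K[#|P|]} face_ideal face_ideal_idealr_closed.

Definition face_ring : comNzRingType := {ideal_quot face_ideal}.

Definition face_ring_pi (p : {mpoly K[#|P|]}) : face_ring :=
  \pi_({ideal_quot face_ideal}) p.

End FaceRing.

Section FaceModule.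
Variables (K : fieldType) (d : Order.disp_t) (P : finBPOrderType d).
Variables (n : nat) (x : 'I_n -> P).

Definition vertex_map (a : {mpoly K[n]}) : face_ring K P :=
  face_ring_pi (a \mPo [tuple poset_var K (x j) | j < n]).

Fact vertex_map_zmod_morphism : zmod_morphism vertex_map.
Proof. by move=> a b; rewrite /vertex_map /face_ring_pi !raddfB. Qed.

Fact vertex_map_monoid_morphism : monoid_morphism vertex_map.
Proof.
by split=> [|a b]; rewrite /vertex_map /face_ring_pi ?comp_mpoly1 ?rmorphM ?rmorph1.
Qed.

HB.instance Definition _ := GRing.isZmodMorphism.Build {mpoly K[n]}
  (face_ring K P) vertex_map vertex_map_zmod_morphism.
HB.instance Definition _ := GRing.isMonoidMorphism.Build {mpoly K[n]}
  (face_ring K P) vertex_map vertex_map_monoid_morphism.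

Definition face_module : Type := face_ring K P.

HB.instance Definition _ := GRing.Zmodule.on face_module.

Definition face_scale (a : {mpoly K[n]}) (u : face_module) : face_module :=
  vertex_map a * (u : face_ring K P).

Fact face_scaleA a b u : face_scale a (face_scale b u) = face_scale (a * b) u.
Proof. by rewrite /face_scale rmorphM mulrA. Qed.
Fact face_scale1 : left_id 1 face_scale.
Proof. by move=> u; rewrite /face_scale rmorph1 mul1r. Qed.
Fact face_scaleDr : right_distributive face_scale +%R.
Proof. by move=> a u v; exact: mulrDr. Qed.
Fact face_scaleDl u : {morph face_scale^~ u : a b / a + b}.
Proof. by move=> a b; rewrite /face_scale rmorphD; exact: mulrDl. Qed.

HB.instance Definition _ := GRing.Zmodule_isLmodule.Build {mpoly K[n]}
  face_module face_scaleA face_scale1 face_scaleDr face_scaleDl.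

(* The degree of a monomial of K[y : y in P], where deg y is the indicator
   function of supp y *)
Definition monomial_deg (m : 'X_{1..#|P|}) : {ffun 'I_n -> int} :=
  [ffun j => (\sum_(y | j \in supp x y) m (enum_rank y))%N%:Z].

Definition face_deg (alpha : {ffun 'I_n -> int}) (u : face_module) : Prop :=
  exists2 p, u = face_ring_pi p &
    forall m, m \in msupp p -> monomial_deg m = alpha.

Definition face_cohomology (i : int) : lmodType {mpoly K[n]} :=
  local_cohomology face_module i.

Definition face_cohomology_deg (i : int) (alpha : {ffun 'I_n -> int})
    (h : face_cohomology i) : Prop :=
  local_cohomology_deg face_deg alpha h.

End FaceModule.

Section PosetCohomology.
Variables (K : fieldType) (d : Order.disp_t) (P : finBPOrderType d).
Variables (n : nat) (x : 'I_n -> P) (O : rel 'I_n).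
Implicit Types Q : {set P}.

Definition cochain_basis Q (i : int) :=
  {y : P | (y \notin Q) && ((rank y)%:Z == i + 1)}.

Definition cochain Q (i : int) : lmodType K := {ffun cochain_basis Q i -> K^o}.

Definition basis_cochain Q i (y : cochain_basis Q i) : cochain Q i :=
  [ffun z => (z == y)%:R].

Definition coboundary_exponent (j : 'I_n) (y : P) : nat :=
  #|[set k in supp x y | O j k && (j != k)]|.

(* The coboundary is [coboundary i (i + 1)]; as for [cech_d], the target degree is
   a separate parameter. *)
Definition coboundary Q (i i' : int) (c : cochain Q i) : cochain Q i' :=
  \sum_(y : cochain_basis Q i) c y *:
    \sum_(j : 'I_n | j \notin supp x (val y))
      (-1) ^+ coboundary_exponent j (val y) *:
      \sum_(z : cochain_basis Q i' | val z \in min_upper_bounds (x j) (val y))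
        basis_cochain z.

Fact coboundary_linear Q i i' : linear (@coboundary Q i i').
Proof.
move=> a b c; rewrite /coboundary scaler_sumr -big_split; apply: eq_bigr => y _.
by rewrite /= !ffunE scalerDl scalerA.
Qed.

HB.instance Definition _ Q i i' := GRing.isLinear.Build K
  (cochain Q i) (cochain Q i') *:%R (@coboundary Q i i') (@coboundary_linear Q i i').

Definition relative_cohomology Q (i : int) : lmodType K :=
  cohomology (@coboundary Q (i - 1) i) (@coboundary Q i (i + 1)).

(* The linear map with y |-> y for y in P \ Q *)
Definition cochain_inclusion Q Q' i (c : cochain Q i) : cochain Q' i :=
  [ffun z => oapp c 0 (insub (val z))].

Definition pair_map Q Q' i :
    relative_cohomology Q i -> relative_cohomology Q' i :=
  cohomology_map _ _ (@cochain_inclusion Q Q' i).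

Let coef (y z : P) : K := \sum_(j : 'I_n | j \notin supp x y)
  (-1) ^+ coboundary_exponent j y * (z \in min_upper_bounds (x j) y)%:R.

Let value Q i (c : cochain Q i) (y : P) : K := oapp c 0 (insub y).

Fact sum_sig (p : pred P) (F : P -> K) :
  \sum_(y : {y | p y}) F (val y) = \sum_(y | p y) F y.
Proof.
rewrite [RHS](reindex_omap (val : {y | p y} -> P) insub) => [|y py].
  by apply: eq_bigl => y; rewrite valK eqxx (valP y).
by rewrite insubT.
Qed.

Fact coboundaryE Q i i' (c : cochain Q i) (z : cochain_basis Q i') :
  coboundary i' c z = \sum_y value c y * coef y (val z).
Proof.
pose p := [pred y | (y \notin Q) && ((rank y)%:Z == i + 1)].
rewrite (bigID p) /= [X in _ = _ + X]big1 ?addr0 => [|y yQ]; last first.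
  by rewrite /value insubN // mul0r.
rewrite -(sum_sig p) /coboundary sum_ffunE; apply: eq_bigr => y _.
rewrite ffunE /value valK /=; congr (_ * _).
rewrite sum_ffunE; apply: eq_bigr => j _; rewrite ffunE; congr (_ * _).
rewrite sum_ffunE big_mkcond (bigD1 z) //= big1 ?addr0 => [|z' /negPf zz'].
  by rewrite ffunE eqxx; case: ifP.
by rewrite ffunE eq_sym zz' if_same.
Qed.

Lemma pair_map_class Q Q' i (c : cochain Q i) :
    (forall y z, z \in Q -> (y <= z)%O -> y \in Q) -> Q' \subset Q ->
    coboundary (i + 1) c = 0 ->
  pair_map Q' (coclass _ _ c : relative_cohomology Q i)
    = coclass _ _ (cochain_inclusion Q' c).
Proof.
move=> Qideal sQ c0.
have valueE k (b : cochain Q k) y : value (cochain_inclusion Q' b) y = value b y.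
  rewrite /value; case: insubP => [z _ <-|ny]; first by rewrite /= ffunE.
  rewrite /= insubN //; apply: contra ny => /andP[yQ ->]; rewrite andbT.
  by apply: contra yQ; exact: (subsetP sQ).
have dE k l (b : cochain Q k) : coboundary l (cochain_inclusion Q' b)
    = cochain_inclusion Q' (coboundary l b).
  apply/ffunP => z; rewrite coboundaryE ffunE.
  under eq_bigr do rewrite valueE.
  case: insubP => [z' _ zz'|zQ] /=; first by rewrite coboundaryE zz'.
  rewrite big1 // => y _; rewrite /value.
  case: insubP => [y' /andP[yQ _] _|_]; last by rewrite mul0r.
  rewrite /coef big1 ?mulr0 // => j _.
  case: (boolP (_ \in _)) => [|_]; last by rewrite mulr0.
  rewrite inE => /andP[/andP[_ yz] _]; case/negP: zQ.
  rewrite (eqP (proj2 (andP (valP z)))) eqxx andbT.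
  by apply: contra yQ => /Qideal; apply.
apply: cohomology_map_class => [a b|a a0|a|//].
- apply/ffunP => z; rewrite !ffunE; case: insub => [y|] /=; last by rewrite subr0.
  by rewrite !ffunE.
- rewrite /= dE a0; apply/ffunP => z; rewrite !ffunE.
  by case: insub => [y|] //=; rewrite ffunE.
- by exists (cochain_inclusion Q' a); rewrite /= dE.
Qed.

(* \bigoplus_(w | supp w = S) H^i(P, cost w) *)
Definition support_face (S : {set 'I_n}) := {w : P | supp x w == S}.

Definition contrastar_sum (S : {set 'I_n}) (i : int) : lmodType K :=
  prod_mod (fun w : support_face S => relative_cohomology (contrastar (val w)) i).

(* The linear map sending the summand of w to the summand of w \ {x_j} *)
Definition remove_vertex_map (j : 'I_n) (S T : {set 'I_n}) (i : int)
    (u : contrastar_sum S i) : contrastar_sum T i := fun z : support_face T =>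
  \sum_(w : support_face S | remove_vertex x (val w) j == val z)
    pair_map (contrastar (val z)) (u w).

End PosetCohomology.

(* Main.v *)
Require Import Defs.
From HB Require Import structures.
From mathcomp Require Import all_boot all_order all_algebra.
From mathcomp Require Import boolp generic_quotient ring_quotient zify.
From mathcomp.multinomials Require Import mpoly.

Set Implicit Arguments.
Unset Strict Implicit.
Unset Printing Implicit Defensive.

Import Order.TTheory GRing.Theory Num.Theory.

Local Open Scope ring_scope.

(** The graded pieces of A_P.  For a face w, sending y to x^(supp y) if y <= w
    and to 0 otherwise defines a ring map from A_P to K[x_1, ..., x_n]
    ([restrict]): below w two faces have exactly one minimal upper bound, and the
    supports of their meet and of this bound are the intersection and the union
    of their supports.  Conversely the defining relations let one rewrite every
    element of degree m as a combination of the elements x^(m - supp w) w with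
    supp w = supp m ([standard_deg]), and the coefficient at w is the coefficient
    of x^m in the restriction to w.  So the faces with support supp m index a
    basis of (A_P)_m.  Inverting x_F, the degree alpha piece of the localization
    is 0 if alpha has a negative entry outside of F, and otherwise has a basis
    indexed by the faces with support F :|: supp alpha ([coord_inj],
    [coord_exists]).

    Positive entries.  If alpha_j > 0, the supports F :|: supp alpha and
    (j |: F) :|: supp alpha agree, so passing from the localization at x_F to the
    one at x_(j |: F) is bijective in degree alpha.  The inverses of these maps
    contract the degree alpha piece of the Cech complex ([cech_homog_exact]).

    Nonpositive degrees.  If alpha <= 0, only the sets F containing supp alpha
    contribute, and the piece at F has for basis the faces with support F.
    Each face whose support contains supp alpha lies above exactly one w with
    supp w = supp alpha, and the faces above w form the basis of the cochains of
    (P, cost w): the degree alpha piece of the Cech complex is the direct sum of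
    these cochain complexes.  The Cech differential is signed by the usual order
    on indices and the coboundary by the orientation O.  One turns into the other
    when each basis element y is multiplied by (-1)^k, with k the number of pairs
    of indices in supp y on which the two orders agree ([orient_sign_remove]).

    The resulting maps [cech_restrict] are defined on the whole Cech complex, as
    projections onto the part of degree alpha, and are chain maps there
    ([cech_restrict_d]).  Thus the isomorphism can be computed on any
    representative of a cohomology class, and homogeneous representatives only
    serve to prove that it is bijective.  Multiplication by x_j shifts the
    coordinates of a cochain, and kills those at faces which do not contain x_j:
    this gives its description when alpha_j < 0.  When alpha_j = 0 the product
    has a degree with a positive entry, so it vanishes. *)

(** * Faces of a simplicial poset *)
Section BooleanIntervals.
Variables (d : Order.disp_t) (P : finBPOrderType d).
Hypothesis simP : simplicial_poset P.

(** In an interval identified with the subsets of a finite set, the size of the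
    subset is strictly increasing along chains, which bounds their length; the
    bound is reached by adding the elements of the subset one at a time. *)
Lemma rank_boolean (u : P) r (f : P -> {set 'I_r}) :
    (forall w z, (w <= u)%O -> (z <= u)%O -> (w <= z)%O = (f w \subset f z)) ->
    (forall S, exists2 w, (w <= u)%O & f w = S) ->
  forall a, (a <= u)%O -> rank a = #|f a|.
Proof.
move=> fle fsur a au; apply/eqP; rewrite eqn_leq; apply/andP; split.
  apply/bigmax_leqP => C /and4P[_ _ /forall_inP Ca /forall_inP Cch].
  have Cu w : w \in C -> (w <= u)%O by move=> wC; apply: le_trans (Ca _ wC) au.
  have cinj : {in C &, injective (fun w => inord #|f w| : 'I_(#|f a|.+1))}.
    have fC w : w \in C -> (#|f w| < #|f a|.+1)%N.
      by move=> wC; rewrite ltnS; apply: subset_leq_card; rewrite -fle ?Ca // Cu.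
    move=> w z wC zC /(congr1 val) /=; rewrite !inordK ?fC // => cwz.
    have fwz : f w = f z.
      have wu := Cu w wC; have zu := Cu z zC.
      have /forall_inP/(_ z zC) := Cch w wC.
      rewrite /Order.comparable (fle w z) // (fle z w) //.
      by case/orP => wz; apply/eqP; [|rewrite eq_sym]; rewrite eqEcard wz cwz leqnn.
    by apply/eqP; rewrite eq_le (fle w z) ?(fle z w) ?Cu // fwz subxx.
  by have := leq_card_in _ _ cinj; rewrite card_ord; case: #|C|.
(* A maximal chain: the prefixes of an enumeration of f a. *)
pose s := enum (f a).
have /choice[g gP] (S : {set 'I_r}) : exists w, (w <= u)%O /\ f w = S.
  by have [w] := fsur S; exists w.
pose h (k : 'I_(#|f a|.+1)) := g [set x in take k s].
have hle (k l : 'I_(#|f a|.+1)) : (k <= l)%N -> (h k <= h l)%O.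
  move=> kl; rewrite /h fle ?(gP _).1 // !(gP _).2; apply/subsetP => x.
  by rewrite !inE -{1}(minn_idPl kl) take_min => /mem_take.
have hcard (k : 'I_(#|f a|.+1)) : #|f (h k)| = k.
  rewrite (gP _).2 cardsE; have /card_uniqP -> := take_uniq k (enum_uniq (f a)).
  by rewrite size_take_min -cardE; apply/minn_idPl; rewrite -ltnS.
have hinj : injective h.
  by move=> k l kl; apply/val_inj; rewrite /= -[RHS]hcard -kl hcard.
have Cch : chain_to a [set h k | k in 'I_(#|f a|.+1)].
  apply/and4P; split.
  - apply/imsetP; exists ord0 => //; apply/eqP; rewrite eq_le le0x /=.
    by rewrite fle ?le0x ?(gP _).1 // (gP _).2 take0; apply/subsetP => x; rewrite !inE.
  - apply/imsetP; exists ord_max => //; rewrite /h /= take_oversize -?cardE //.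
    have -> : [set x in s] = f a by apply/setP => x; rewrite inE mem_enum.
    by apply/eqP; rewrite eq_le (fle a) ?(fle _ a) ?(gP _).1 // (gP _).2 subxx.
  - apply/forall_inP => _ /imsetP[k _ ->]; rewrite fle ?(gP _).1 // (gP _).2.
    by apply/subsetP => x; rewrite inE => /mem_take; rewrite mem_enum.
  - apply/forall_inP => _ /imsetP[k _ ->]; apply/forall_inP => _ /imsetP[l _ ->].
    by rewrite /Order.comparable; case/orP: (leq_total k l) => /hle ->; rewrite ?orbT.
have := @leq_bigmax_cond _ (chain_to a) (fun C => #|C|.-1) _ Cch.
by rewrite card_imset // card_ord.
Qed.

Variables (n : nat) (x : 'I_n -> P).
Hypothesis labx : vertex_labeling x.

(** By [rank_boolean] the atoms of the interval below u are its vertices, so the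
    supports themselves identify this interval with the subsets of supp u.  All
    later arguments use the interval in this form. *)
Lemma boolean_supp (u : P) :
  [/\ forall a b, (a <= u)%O -> (b <= u)%O -> (a <= b)%O = (supp x a \subset supp x b),
      forall S : {set 'I_n}, S \subset supp x u -> exists2 a, (a <= u)%O & supp x a = S
    & rank u = #|supp x u|].
Proof.
have [injx rkx] := labx; have [r [f [fle fsur]]] := simP u.
have rkE := rank_boolean fle fsur.
have f1 j : (x j <= u)%O -> exists i, f (x j) = [set i].
  by move=> xj; apply/cards1P; rewrite -rkE //; apply/eqP/rkx; exists j.
have fx i : exists2 j, (x j <= u)%O & f (x j) = [set i].
  have [a au fa] := fsur [set i].
  have /rkx[j xj] : rank a = 1%N by rewrite rkE // fa cards1.
  by exists j; rewrite xj.
have fsupp a i j : (a <= u)%O -> (x j <= u)%O -> f (x j) = [set i] ->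
    (j \in supp x a) = (i \in f a).
  by move=> au xj fj; rewrite inE fle // fj sub1set.
have finj j k : (x j <= u)%O -> (x k <= u)%O -> f (x j) = f (x k) -> j = k.
  move=> ju ku jk; apply: injx; apply/eqP.
  by rewrite eq_le (fle (x j)) // (fle (x k)) // jk subxx.
split.
- move=> a b au bu; apply/idP/subsetP => [ab j|sab].
    by rewrite !inE => /le_trans; apply.
  rewrite fle //; apply/subsetP => i; have [j ju fj] := fx i.
  by rewrite -!(fsupp _ _ j) //; apply: sab.
- move=> S /subsetP Su; have [a au fa] := fsur [set i | [exists j in S, i \in f (x j)]].
  exists a => //; apply/setP => j.
  have xu k : k \in S -> (x k <= u)%O by move/Su; rewrite inE.
  apply/idP/idP => [ja|jS].
    have ju : (x j <= u)%O by move: ja; rewrite inE => /le_trans; apply.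
    have [i fj] := f1 j ju; move: ja; rewrite (fsupp _ i) // fa inE.
    case/exists_inP => k kS; have [l fk] := f1 k (xu k kS).
    rewrite fk inE => /eqP il; suff -> : j = k by [].
    by apply: finj; [|exact: xu|rewrite fj fk il].
  have [i fj] := f1 j (xu j jS); rewrite (fsupp _ i) ?xu // fa inE.
  by apply/exists_inP; exists j; rewrite // fj set11.
rewrite rkE //.
have /choice[h hP] i : exists j, (x j <= u)%O /\ f (x j) = [set i].
  by have [j] := fx i; exists j.
have hinj : injective h.
  move=> i k hik; have := (hP i).2; rewrite hik (hP k).2.
  by move/setP/(_ k); rewrite !inE eqxx => /esym/eqP.
rewrite -(card_imset _ hinj); apply: eq_card => j; apply/imsetP/idP => [[i ifu ->]|].
  by rewrite inE (hP i).1.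
move=> ju; have ju' : (x j <= u)%O by move: ju; rewrite inE.
have [i fj] := f1 j ju'; exists i; first by rewrite -(fsupp _ i j).
by apply: finj; rewrite ?(hP i).1 // fj (hP i).2.
Qed.

Lemma le_supp (u a b : P) : (a <= u)%O -> (b <= u)%O ->
  (a <= b)%O = (supp x a \subset supp x b).
Proof. by have [H _ _] := boolean_supp u; apply: H. Qed.

Lemma supp_le (a b : P) : (a <= b)%O -> supp x a \subset supp x b.
Proof. by move=> ab; rewrite -(le_supp ab (lexx b)). Qed.

Lemma face_of_supp (u : P) (S : {set 'I_n}) : S \subset supp x u ->
  exists2 a, (a <= u)%O & supp x a = S.
Proof. by have [_ H _] := boolean_supp u; apply: H. Qed.

Lemma rank_supp (u : P) : rank u = #|supp x u|.
Proof. by have [] := boolean_supp u. Qed.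

Lemma supp_inj (u a b : P) : (a <= u)%O -> (b <= u)%O ->
  supp x a = supp x b -> a = b.
Proof.
move=> au bu ab; apply/eqP.
by rewrite eq_le (le_supp au bu) (le_supp bu au) ab subxx.
Qed.

Lemma supp_bot : supp x \bot%O = set0.
Proof.
have [b _ b0] := face_of_supp (sub0set (supp x \bot%O)).
by apply/eqP; rewrite -subset0 -b0 supp_le ?le0x.
Qed.

Lemma supp_vertex j : supp x (x j) = [set j].
Proof.
have [injx rkx] := labx; apply/esym/eqP.
have /eqP := (rkx (x j)).2 (ex_intro _ j erefl).
rewrite rank_supp => /cards1P[i Ei].
have : j \in supp x (x j) by rewrite inE lexx.
by rewrite Ei inE => /eqP ->.
Qed.

Lemma supp_mub (a b z : P) : z \in min_upper_bounds a b ->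
  supp x z = supp x a :|: supp x b.
Proof.
rewrite inE => /andP[/andP[az bz] /forallP zmin].
have sub : supp x a :|: supp x b \subset supp x z by rewrite subUset !supp_le.
have [c cz sc] := face_of_supp sub.
have /implyP := zmin c; rewrite /upper_bound cz (le_supp az cz) (le_supp bz cz) sc.
by rewrite subsetUl subsetUr => /(_ isT) /eqP <-.
Qed.

Lemma mub_supp (a b z : P) : (z \in min_upper_bounds a b) =
  [&& (a <= z)%O, (b <= z)%O & supp x z == supp x a :|: supp x b].
Proof.
apply/idP/and3P => [zM|[az bz /eqP sz]].
  rewrite (supp_mub zM); move: zM; rewrite inE => /andP[/andP[-> ->] _]; by [].
rewrite inE /upper_bound az bz; apply/forallP => u; apply/implyP.
move=> /andP[/andP[au bu] uz]; apply/eqP/(supp_inj uz (lexx z))/eqP.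
by rewrite eqEsubset supp_le // sz subUset !supp_le.
Qed.

Lemma supp_wedge (a b u : P) : (a <= u)%O -> (b <= u)%O ->
  supp x (wedge a b) = supp x a :&: supp x b /\ (wedge a b <= a)%O.
Proof.
move=> au bu.
have [c ca sc] := face_of_supp (subsetIl (supp x a) (supp x b)).
have cu := le_trans ca au.
have cb : (c <= b)%O by rewrite (le_supp cu bu) sc subsetIr.
have cmax v : (v <= a)%O && (v <= b)%O -> (v <= c)%O.
  by move=> /andP[va vb]; rewrite (le_supp (le_trans va au) cu) sc subsetI !supp_le.
rewrite /wedge; case: pickP => [m /and3P[ma mb /forallP mm]|/(_ c)].
  suff -> : odflt \bot%O (Some m) = c by rewrite sc.
  apply/eqP; rewrite eq_le cmax /= ?ma ?mb //.
  by have /implyP := mm c; rewrite ca cb; apply.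
rewrite ca cb /= => /negbT/forallPn[v]; rewrite negb_imply => /andP[/cmax ->] //.
Qed.

Lemma remove_vertexP (w : P) j : j \in supp x w ->
  (remove_vertex x w j <= w)%O /\ supp x (remove_vertex x w j) = supp x w :\ j.
Proof.
move=> jw; rewrite /remove_vertex; case: pickP => [v /andP[vw /eqP] //|/=].
have [v vw sv] := face_of_supp (subD1set (supp x w) j).
by move/(_ v); rewrite vw sv eqxx.
Qed.

Lemma remove_vertex_unique (w v : P) j : j \in supp x w -> (v <= w)%O ->
  supp x v = supp x w :\ j -> remove_vertex x w j = v.
Proof.
move=> jw vw sv; have [rw sr] := remove_vertexP jw.
by apply: (supp_inj rw vw); rewrite sr.
Qed.

(** The faces covering y in the direction of x_j, seen from above: this turns the
    coboundary into a sum over the vertices of the larger face. *)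
Lemma mub_vertex (j : 'I_n) (y z : P) : j \notin supp x y ->
  (z \in min_upper_bounds (x j) y) = (j \in supp x z) && (remove_vertex x z j == y).
Proof.
move=> jy; rewrite mub_supp supp_vertex; apply/and3P/andP => [[xz yz /eqP sz]|[jz /eqP <-]].
  have jz : j \in supp x z by rewrite sz !inE eqxx.
  split=> //; apply/eqP/remove_vertex_unique => //.
  rewrite sz; apply/setP => k; rewrite !inE; case: eqP => //= ->.
  by move: jy; rewrite inE => /negbTE.
have [rz sr] := remove_vertexP jz; split=> //; first by move: jz; rewrite inE.
by rewrite sr setD1K.
Qed.

End BooleanIntervals.

(** * Restricting the face ring to a face *)
Definition msup n (m : 'X_{1..n}) : {set 'I_n} := [set j | m j != 0%N].

Lemma msup_mesym1 n (S : {set 'I_n}) : msup (mesym1 S) = S.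
Proof. by apply/setP => j; rewrite inE mnmE; case: (j \in S). Qed.

Lemma msupD n (m m' : 'X_{1..n}) : msup (m + m') = msup m :|: msup m'.
Proof. by apply/setP => j; rewrite !inE mnmDE addn_eq0 negb_and. Qed.

Lemma xprodE (K : fieldType) n (F : {set 'I_n}) : xprod K F = 'X_[mesym1 F].
Proof.
rewrite /xprod mprodXE; congr ('X_[_]); apply/mnmP => j; rewrite mnm_sumE mnmE.
under eq_bigr do rewrite mnm1E.
case: (boolP (j \in F)) => jF; last first.
  by rewrite big1 // => i iF; case: eqP iF jF => // -> ->.
by rewrite (bigD1 j) //= eqxx big1 // => i /andP[_ /negPf->].
Qed.

Section FaceRing.
Variables (K : fieldType) (d : Order.disp_t) (P : finBPOrderType d).
Variables (n : nat) (x : 'I_n -> P).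
Hypothesis simP : simplicial_poset P.
Hypothesis labx : vertex_labeling x.

Local Notation AP := (@Defs_face_module__canonical__GRing_Lmodule K d P n x).

(** The map from A_P to K[x_1, ..., x_n] attached to w, before passing to the
    quotient by the face relations. *)
Definition restrict_poly (w : P) : {mpoly K[#|P|]} -> {mpoly K[n]} :=
  comp_mpoly [tuple if (enum_val i <= w)%O
                    then 'X_[mesym1 (supp x (enum_val i))] else 0 | i < #|P|].

HB.instance Definition _ w := GRing.LRMorphism.copy (restrict_poly w)
  (comp_mpoly [tuple if (enum_val i <= w)%O
                     then 'X_[mesym1 (supp x (enum_val i))] else 0 | i < #|P|]).

Lemma restrict_poly_var w y : restrict_poly w (poset_var K y) =
  if (y <= w)%O then 'X_[mesym1 (supp x y)] else 0.
Proof. by rewrite /restrict_poly comp_mpolyXU -tnth_nth tnth_mktuple enum_rankK. Qed.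

(** Below w, a and b have one minimal upper bound c, and x^a x^b equals
    x^(a :&: b) x^(a :|: b) on supports.  If a or b is not below w, neither is
    any of their upper bounds. *)
Lemma restrict_poly_relation w t : restrict_poly w (face_relation K t) = 0.
Proof.
case: t => [[a b]|] /=; last first.
  rewrite rmorphB rmorph1 /= restrict_poly_var.
  by rewrite le0x (supp_bot simP labx) mesym1_set0 mpolyX0 subrr.
rewrite rmorphB !rmorphM rmorph_sum /= !restrict_poly_var.
under [X in _ - _ * X]eq_bigr do rewrite restrict_poly_var.
case: (boolP ((a <= w)%O && (b <= w)%O)) => [/andP[aw bw]|nab].
  rewrite aw bw; have [swe wea] := supp_wedge simP labx aw bw.
  rewrite (le_trans wea aw) swe.
  have sub : supp x a :|: supp x b \subset supp x w.
    by rewrite subUset !(supp_le simP labx).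
  have [c cw sc] := face_of_supp simP labx sub.
  have cM : c \in min_upper_bounds a b.
    rewrite (mub_supp simP labx) (le_supp simP labx aw cw) (le_supp simP labx bw cw).
    by rewrite sc subsetUl subsetUr eqxx.
  rewrite (bigD1 c) //= cw big1 ?addr0 => [|z /andP[zM /eqP zc]].
    rewrite -!mpolyXD sc; apply/eqP; rewrite subr_eq0; apply/eqP; congr ('X_[_]).
    apply/mnmP => j; rewrite !mnmDE !mnmE in_setI in_setU.
    by case: (j \in supp x a); case: (j \in supp x b).
  case: ifP => // zw; case: zc; apply: (supp_inj simP labx zw cw).
  by rewrite (supp_mub simP labx zM) sc.
rewrite [X in _ - _ * X]big1 ?mulr0 ?subr0; last first.
  move=> z; rewrite inE => /andP[/andP[az bz] _]; case: ifP => // zw.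
  by rewrite (le_trans az zw) (le_trans bz zw) in nab.
by move: nab; do 2!case: ifP; rewrite ?mulr0 ?mul0r.
Qed.

Lemma restrict_poly_ideal w p : p \in @face_ideal K d P -> restrict_poly w p = 0.
Proof.
move=> /asboolP[a ->]; rewrite rmorph_sum big1 // => t _ /=.
by rewrite rmorphM /= restrict_poly_relation mulr0.
Qed.

Lemma face_ring_piK p q : face_ring_pi p = face_ring_pi q :> face_ring K P ->
  p - q \in @face_ideal K d P.
Proof. by move=> /eqP; rewrite /face_ring_pi -Quotient.idealrBE. Qed.

Definition restrict (w : P) (u : AP) : {mpoly K[n]} :=
  restrict_poly w (repr (u : {ideal_quot @face_ideal K d P})).

Lemma restrict_pi w p : restrict w (face_ring_pi p) = restrict_poly w p.
Proof.
apply/eqP; rewrite -subr_eq0 /restrict -rmorphB /= restrict_poly_ideal //.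
by apply: face_ring_piK; rewrite /face_ring_pi reprK.
Qed.

Lemma face_ring_piP (u : AP) : exists p, u = face_ring_pi p :> face_ring K P.
Proof. by exists (repr (u : {ideal_quot @face_ideal K d P})); rewrite /face_ring_pi reprK. Qed.

Lemma face_ring_piM p q :
  face_ring_pi (p * q) = face_ring_pi p * face_ring_pi q :> face_ring K P.
Proof. by rewrite /face_ring_pi rmorphM. Qed.

Lemma face_ring_piD p q :
  face_ring_pi (p + q) = face_ring_pi p + face_ring_pi q :> face_ring K P.
Proof. by rewrite /face_ring_pi rmorphD. Qed.

Lemma face_scaleE (a : {mpoly K[n]}) (u : AP) : a *: u = (vertex_map x a * u : face_ring K P).
Proof. by []. Qed.

Lemma face_scale_pi (a : {mpoly K[n]}) p :
  a *: (face_ring_pi p : AP) =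
  face_ring_pi ((a \mPo [tuple poset_var K (x j) | j < n]) * p).
Proof. by rewrite face_scaleE face_ring_piM. Qed.

Lemma restrictD w (u v : AP) : restrict w (u + v) = restrict w u + restrict w v.
Proof.
have [[p ->] [q ->]] := (face_ring_piP u, face_ring_piP v).
have -> : (face_ring_pi p : AP) + face_ring_pi q = face_ring_pi (p + q).
  by rewrite face_ring_piD.
by rewrite !restrict_pi rmorphD.
Qed.

Lemma restrictZ w (c : K) (u : AP) : restrict w (c%:MP *: u) = c%:MP * restrict w u.
Proof.
have [p ->] := face_ring_piP u.
rewrite face_scale_pi !restrict_pi rmorphM /= comp_mpolyC; congr (_ * _).
exact: comp_mpolyC.
Qed.

Lemma restrictX w (m : 'X_{1..n}) (u : AP) : restrict w ('X_[m] *: u) =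
  if msup m \subset supp x w then 'X_[m] * restrict w u else 0.
Proof.
have [p ->] := face_ring_piP u.
rewrite face_scale_pi !restrict_pi rmorphM comp_mpolyX rmorph_prod /=.
have E j : restrict_poly w (tnth [tuple poset_var K (x j0) | j0 < n] j ^+ m j)
    = (if j \in supp x w then 'X_j else 0) ^+ m j.
  rewrite tnth_mktuple rmorphXn /= restrict_poly_var (supp_vertex simP labx).
  by rewrite mesym1_set1 inE.
under eq_bigr do rewrite E.
case: ifP => [/subsetP sm|/negbT/subsetPn[j jm jw]].
  rewrite [X in _ = X * _]mpolyXE_id; congr (_ * _); apply: eq_bigr => j _.
  have [->|mj] := eqVneq (m j) 0%N; first by rewrite !expr0.
  by rewrite sm // inE.
rewrite (bigD1 j) //= (negPf jw) expr0n; move: jm; rewrite inE => /negPf ->.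
by rewrite !mul0r.
Qed.

Definition face_class (y : P) : AP := face_ring_pi (poset_var K y).

Lemma restrict_class w y :
  restrict w (face_class y) = if (y <= w)%O then 'X_[mesym1 (supp x y)] else 0.
Proof. by rewrite restrict_pi restrict_poly_var. Qed.

Lemma face_class_relation t : face_ring_pi (face_relation K t) = 0 :> face_ring K P.
Proof.
suff /eqP : face_ring_pi (face_relation K t) == face_ring_pi 0 :> face_ring K P.
  by rewrite {2}/face_ring_pi rmorph0.
rewrite /face_ring_pi -Quotient.idealrBE subr0; apply/asboolP.
exists [ffun u => (u == t)%:R]; rewrite (bigD1 t) //= ffunE eqxx mul1r big1 ?addr0 //.
by move=> u /negPf ut; rewrite ffunE ut mul0r.
Qed.

Lemma face_class_bot : face_class \bot%O = 1 :> face_ring K P.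
Proof.
have := face_class_relation None; rewrite /face_ring_pi /= rmorphB rmorph1.
by move/eqP; rewrite subr_eq0 => /eqP.
Qed.

Lemma face_classM a b : face_class a * face_class b =
  (face_class (wedge a b) : face_ring K P) *
  \sum_(z in min_upper_bounds a b) (face_class z : face_ring K P) :> face_ring K P.
Proof.
have := face_class_relation (Some (a, b)).
rewrite /face_ring_pi /= rmorphB !rmorphM rmorph_sum /=.
by move/eqP; rewrite subr_eq0 => /eqP.
Qed.

Lemma scale_vertex j (u : AP) :
  'X_j *: u = (face_class (x j) * u : face_ring K P).
Proof.
rewrite face_scaleE /vertex_map comp_mpolyXU -tnth_nth tnth_mktuple.
by [].
Qed.

(** Induction on the size of supp a.  Let b be a without x_j: as x_j and b only
    meet in the bottom, x_j b is the sum of their minimal upper bounds z.  Times w,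
    only z = a survives, since below a common upper bound of w and z the faces z
    and a have the same support. *)
Lemma face_classM_le a w : (a <= w)%O ->
  face_class w * face_class a = 'X_[mesym1 (supp x a)] *: face_class w :> face_ring K P.
Proof.
have [k] := ubnP #|supp x a|; elim: k a => // k IH a ak aw.
have [a0|[j ja]] := set_0Vmem (supp x a).
  rewrite a0 mesym1_set0 mpolyX0 scale1r.
  have -> : a = \bot%O.
    by apply: (supp_inj simP labx aw (le0x w)); rewrite a0 (supp_bot simP labx).
  by rewrite face_class_bot mulr1.
have [ba sb] := remove_vertexP simP labx ja; set b := remove_vertex x a j in ba sb.
have bw := le_trans ba aw.
have xa : (x j <= a)%O by move: ja; rewrite inE.
have w0 : wedge (x j) b = \bot%O.
  have [sw wx] := supp_wedge simP labx xa ba.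
  apply: (supp_inj simP labx (le_trans wx xa) (le0x a)).
  rewrite sw (supp_vertex simP labx) sb (supp_bot simP labx).
  by apply/setP => i; rewrite !inE; case: eqP.
have aM : a \in min_upper_bounds (x j) b.
  by rewrite (mub_supp simP labx) xa ba sb (supp_vertex simP labx) setD1K //=.
have /esym := face_classM (x j) b; rewrite w0 face_class_bot mul1r.
move/(congr1 (fun u : face_ring K P => (face_class w : face_ring K P) * u)).
rewrite mulr_sumr (bigD1 a) //= big1 ?addr0 => [->|z /andP[zM /eqP za]]; last first.
  rewrite face_classM big1 ?mulr0 // => u.
  rewrite inE => /andP[/andP[wu zu] _]; case: za.
  apply: (supp_inj simP labx zu (le_trans aw wu)).
  by rewrite (supp_mub simP labx zM) (supp_mub simP labx aM).
rewrite mulrCA IH //; last first.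
  by move: ak; rewrite (cardsD1 j) ja sb.
rewrite -scale_vertex scalerA -mpolyXD.
suff -> : (U_(j) + mesym1 (supp x b))%MM = mesym1 (supp x a) by [].
apply/mnmP => i; rewrite mnmDE mnm1E !mnmE sb !in_setD1.
by have [<-|_] := eqVneq j i; rewrite ?ja.
Qed.

(** The straightening rule: the factor that the relation puts in front of the sum
    is a face below each z, so it acts on z as a monomial in the vertices. *)
Lemma face_classM_mub a w : face_class a * face_class w =
  \sum_(z in min_upper_bounds a w)
    'X_[mesym1 (supp x a :&: supp x w)] *: (face_class z : AP) :> face_ring K P.
Proof.
rewrite face_classM mulr_sumr; apply: eq_bigr => z.
rewrite inE => /andP[/andP[az wz] _]; have [sw wa] := supp_wedge simP labx az wz.
by rewrite mulrC face_classM_le ?sw // (le_trans wa).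
Qed.

End FaceRing.

(** * The graded pieces of the face ring *)
Definition intdeg n (m : 'X_{1..n}) : {ffun 'I_n -> int} := [ffun j => (m j)%:Z].

Lemma intdegD n (m m' : 'X_{1..n}) : intdeg (m + m')%MM = intdeg m + intdeg m'.
Proof. by apply/ffunP => j; rewrite !ffunE mnmDE PoszD. Qed.

Lemma intdeg_inj n : injective (@intdeg n).
Proof. by move=> m m' /ffunP mm; apply/mnmP => j; have := mm j; rewrite !ffunE => -[]. Qed.

Lemma intdegP n (beta : {ffun 'I_n -> int}) :
  (forall j, 0 <= beta j) -> exists m, beta = intdeg m.
Proof.
move=> b0; exists [multinom `|beta j|%N | j < n]; apply/ffunP => j.
by rewrite ffunE mnmE gez0_abs.
Qed.

Section HomogeneousPieces.
Variables (K : fieldType) (d : Order.disp_t) (P : finBPOrderType d).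
Variables (n : nat) (x : 'I_n -> P).
Hypothesis simP : simplicial_poset P.
Hypothesis labx : vertex_labeling x.

Local Notation AP := (@Defs_face_module__canonical__GRing_Lmodule K d P n x).
Local Notation restrict := (@restrict K d P n x).
Local Notation face_class := (@face_class K d P n x).

Definition exponent_deg (M : 'X_{1..#|P|}) : 'X_{1..n} :=
  [multinom (\sum_(y | j \in supp x y) M (enum_rank y))%N | j < n].

Lemma monomial_degE M : monomial_deg x M = intdeg (exponent_deg M).
Proof. by apply/ffunP => j; rewrite !ffunE mnmE. Qed.

Lemma exponent_degD M M' :
  exponent_deg (M + M')%MM = (exponent_deg M + exponent_deg M')%MM.
Proof.
by apply/mnmP => j; rewrite mnmDE !mnmE -big_split; apply: eq_bigr => y _; rewrite mnmDE.
Qed.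

Lemma exponent_deg_var y : exponent_deg U_(enum_rank y)%MM = mesym1 (supp x y).
Proof.
apply/mnmP => j; rewrite !mnmE.
under eq_bigr do rewrite mnm1E (inj_eq enum_rank_inj) eq_sym.
case: (boolP (j \in supp x y)) => jy.
  by rewrite (bigD1 y) //= eqxx big1 // => z /andP[_ /negPf->].
by rewrite big1 // => z jz; case: eqP jz jy => // -> ->.
Qed.

Lemma exponent_deg0 : exponent_deg 0%MM = 0%MM.
Proof. by apply/mnmP => j; rewrite !mnmE big1 // => y _; rewrite mnm0E. Qed.

Lemma monomial_rect (Q : 'X_{1..#|P|} -> Prop) :
  Q 0%MM -> (forall y M, Q M -> Q (U_(enum_rank y) + M)%MM) -> forall M, Q M.
Proof.
move=> Q0 QS M; have [k] := ubnP (mdeg M); elim: k M => // k IH M Mk.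
have [->//|] := eqVneq M 0%MM; rewrite -mdeg_eq0 mdegE sum_nat_eq0.
case/forallPn => i /= Mi.
have Ui : (U_(i) <= M)%MM by rewrite lep1mP.
rewrite -(submK Ui) addmC -[i]enum_valK; apply/QS/IH.
by move: Mk; rewrite -{1}(submK Ui) mdegD mdeg1 enum_valK addn1.
Qed.

Lemma restrict_poly_monomial w M : restrict_poly x w 'X_[K, M] =
  if [forall y, (M (enum_rank y) != 0%N) ==> (y <= w)%O]
  then 'X_[exponent_deg M] else 0.
Proof.
move: M; apply: monomial_rect => [|y M IH].
  rewrite exponent_deg0 !mpolyX0 rmorph1; case: ifP => // /negP[].
  by apply/forallP => y; rewrite mnm0E.
rewrite mpolyXD rmorphM /= IH -/(poset_var K y) restrict_poly_var exponent_degD.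
rewrite exponent_deg_var mpolyXD; case: ifP => yw; last first.
  rewrite mul0r; case: ifP => // /forallP/(_ y).
  by rewrite mnmDE mnm1E eqxx add1n yw.
have -> : [forall z, ((U_(enum_rank y) + M)%MM (enum_rank z) != 0%N) ==> (z <= w)%O]
    = [forall z, (M (enum_rank z) != 0%N) ==> (z <= w)%O].
  apply: eq_forallb => z; rewrite mnmDE mnm1E (inj_eq enum_rank_inj).
  by have [<-|_] := eqVneq y z; rewrite ?add0n // yw !implybT.
by case: ifP; rewrite ?mulr0.
Qed.

(** A monomial whose image is x^m and whose variables lie below w only involves
    faces with support in supp m, and those are below u as soon as supp u contains
    supp m.  Thus restrictions to u and to w agree in these degrees, which makes
    the coordinates of one element at different faces comparable. *)
Lemma restrict_coef_le (u w : P) (p : AP) m : (u <= w)%O -> msup m \subset supp x u ->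
  (restrict u p)@_m = (restrict w p)@_m.
Proof.
move=> uw mu; have [{}p ->] := face_ring_piP p.
have coefE v : (restrict v (face_ring_pi p : AP))@_m =
    \sum_(M <- msupp p) p@_M * (restrict_poly x v 'X_[M])@_m.
  rewrite restrict_pi // {1}[p]mpolyE (linear_sum (restrict_poly x v)) raddf_sum.
  by apply: eq_bigr => M _; rewrite linearZ /= mcoeffZ.
rewrite !coefE; apply: eq_bigr => M _; congr (_ * _); rewrite !restrict_poly_monomial.
case: ifP => Mu; case: ifP => Mw //; rewrite ?mcoeff0 mcoeffX; case: eqP => // Mm.
  case/negP: Mw; apply/forallP => y; apply/implyP => My.
  by apply: le_trans uw; apply: (implyP (forallP Mu y)).
case/negP: Mu; apply/forallP => y; apply/implyP => My.
rewrite (le_supp simP labx (implyP (forallP Mw y) My) uw).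
apply: subset_trans mu; apply/subsetP => j jy; rewrite -Mm inE mnmE.
by rewrite (bigD1 y) //= addn_eq0 negb_and My.
Qed.

Lemma face_deg0 beta : face_deg x beta (0 : AP).
Proof. by exists 0; rewrite ?msupp0 // /face_ring_pi rmorph0. Qed.

Lemma face_degD beta (u v : AP) :
  face_deg x beta u -> face_deg x beta v -> face_deg x beta (u + v).
Proof.
move=> [p -> hp] [q -> hq]; exists (p + q); first by rewrite face_ring_piD.
by move=> m /msuppD_le; rewrite mem_cat => /orP[/hp|/hq].
Qed.

Lemma face_degZ beta (c : K) (u : AP) :
  face_deg x beta u -> face_deg x beta (c%:MP *: u : AP).
Proof.
move=> [p -> hp]; exists (c *: p); last by move=> m /msuppZ_le /hp.
by rewrite face_scale_pi comp_mpolyC mul_mpolyC.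
Qed.

Lemma face_degX beta m (u : AP) :
  face_deg x beta u -> face_deg x (beta + intdeg m) ('X_[m] *: u : AP).
Proof.
move=> [p -> hp]; rewrite face_scale_pi comp_mpolyX.
under eq_bigr do rewrite tnth_mktuple /poset_var mpolyXn.
rewrite mprodXE; eexists; first by [].
move=> M; rewrite mulrC (perm_mem (msuppMX _ _)) => /mapP[M' /hp hM' ->].
rewrite monomial_degE exponent_degD intdegD addrC -monomial_degE hM'; congr (_ + intdeg _).
have ED (I : Type) (r : seq I) (F : I -> 'X_{1..#|P|}) :
    exponent_deg (\sum_(i <- r) F i)%MM = (\sum_(i <- r) exponent_deg (F i))%MM.
  exact: (big_morph _ exponent_degD exponent_deg0).
have EM k y : exponent_deg (U_(enum_rank y) *+ k)%MM = (mesym1 (supp x y) *+ k)%MM.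
  elim: k => [|k IH]; rewrite ?mulm0n ?exponent_deg0 //.
  by rewrite !mulmS exponent_degD IH exponent_deg_var.
rewrite ED [RHS]multinomUE_id; apply: eq_bigr => j _.
by rewrite EM (supp_vertex simP labx) mesym1_set1.
Qed.

Lemma face_deg_class y : face_deg x (intdeg (mesym1 (supp x y))) (face_class y).
Proof.
exists (poset_var K y) => // m; rewrite msuppX inE => /eqP ->.
by rewrite monomial_degE exponent_deg_var.
Qed.

(** A nonzero representative would have a monomial of negative degree. *)
Lemma face_deg_neg beta j (u : AP) : face_deg x beta u -> beta j < 0 -> u = 0.
Proof.
move=> [p -> hp] bj; have [->|p0] := eqVneq p 0; first by rewrite /face_ring_pi rmorph0.
have : mlead p \in msupp p by rewrite mlead_supp.
by move=> /hp bE; move: bj; rewrite -bE ffunE.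
Qed.

(** The subtraction of exponents is truncated, but on the faces of the sum m is
    at least 1 on supp w. *)
Definition standard (m : 'X_{1..n}) (u : AP) : Prop := exists c : P -> K,
  u = \sum_(w | supp x w == msup m) (c w *: 'X_[m - mesym1 (supp x w)]) *: face_class w.

Lemma standard0 m : standard m 0.
Proof. by exists (fun=> 0); rewrite big1 // => w _; rewrite !scale0r. Qed.

Lemma standardD m u v : standard m u -> standard m v -> standard m (u + v).
Proof.
move=> [a ->] [b ->]; exists (fun w => a w + b w).
by rewrite -big_split; apply: eq_bigr => w _; rewrite scalerDl scalerDl.
Qed.

Lemma standardZ m (c : K) u : standard m u -> standard m (c%:MP *: u).
Proof.
move=> [a ->]; exists (fun w => c * a w).
rewrite scaler_sumr; apply: eq_bigr => w _.
by rewrite scalerA mul_mpolyC scalerA.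
Qed.

Lemma standard_sum (I : Type) (r : seq I) (Q : pred I) m (F : I -> AP) :
  (forall i, Q i -> standard m (F i)) -> standard m (\sum_(i <- r | Q i) F i).
Proof. move=> h; apply: big_ind => //; [exact: standard0 | exact: standardD]. Qed.

Lemma standard_term (c : K) m w : msup m \subset supp x w ->
  standard (m + mesym1 (supp x w)) ((c *: 'X_[m]) *: face_class w).
Proof.
move=> mw; exists (fun v => if v == w then c else 0).
rewrite (bigD1 w) /=; last by rewrite msupD msup_mesym1 eq_sym; apply/eqP/setUidPr.
rewrite eqxx addmK big1 ?addr0 // => v /andP[_ /negPf->].
by rewrite !scale0r.
Qed.

(** Each term of the product is straightened by [face_classM_mub]; the exponents
    match because the supports of y and w overlap exactly in the indices where
    the union loses one unit. *)
Lemma face_classM_standard y m (u : AP) : standard m u ->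
  standard (mesym1 (supp x y) + m) (face_class y * (u : face_ring K P) : face_ring K P).
Proof.
move=> [c ->].
have mulZ (a : {mpoly K[n]}) (v w : face_ring K P) :
    v * (a *: (w : AP)) = (a *: (v * w : AP) : AP) :> face_ring K P.
  by rewrite !face_scaleE mulrCA.
rewrite (mulr_sumr (R := face_ring K P)).
apply: standard_sum => w /eqP wm.
rewrite mulZ (face_classM_mub K simP labx) scaler_sumr.
apply: standard_sum => z zM; have sz := supp_mub simP labx zM.
rewrite scalerA -scalerAl -mpolyXD.
have -> : (mesym1 (supp x y) + m = (m - mesym1 (supp x w)
    + mesym1 (supp x y :&: supp x w)) + mesym1 (supp x z))%MM.
  apply/mnmP => j; rewrite !mnmDE mnmBE !mnmE sz in_setI in_setU.
  have : (j \in supp x w) = (m j != 0%N) by rewrite wm inE.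
  by case: (j \in supp x y); case: (j \in supp x w); case: (m j) => //= *; lia.
apply: standard_term; rewrite msupD msup_mesym1 subUset sz.
rewrite (subset_trans (subsetIl _ _) (subsetUl _ _)) andbT.
apply/subsetP => j; rewrite inE mnmBE mnmE => mj; rewrite in_setU orbC wm inE.
by move: mj; case: (m j).
Qed.

Lemma standard_monomial M : standard (exponent_deg M) (face_ring_pi 'X_[K, M]).
Proof.
move: M; apply: monomial_rect => [|y M IH]; last first.
  rewrite exponent_degD exponent_deg_var mpolyXD face_ring_piM.
  exact: face_classM_standard.
have := @standard_term 1 0%MM \bot%O.
rewrite scale1r mpolyX0 scale1r (face_class_bot K) (supp_bot simP labx) mesym1_set0 addm0.
rewrite exponent_deg0 mpolyX0 /face_ring_pi rmorph1; apply.
by apply/subsetP => j; rewrite inE mnm0E.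
Qed.

Lemma standard_deg m (u : AP) : face_deg x (intdeg m) u -> standard m u.
Proof.
move=> [p -> hp]; rewrite [p]mpolyE big_seq.
rewrite /face_ring_pi raddf_sum; apply: standard_sum => M /hp.
rewrite monomial_degE => /intdeg_inj <-.
have := standardZ p@_M (standard_monomial M).
by rewrite face_scale_pi comp_mpolyC mul_mpolyC.
Qed.

(** Faces with the same support as w and below w are equal to w, so all the other
    terms restrict to 0 on w. *)
Lemma standard_coef m (c : P -> K) w : supp x w = msup m ->
  (restrict w (\sum_(v | supp x v == msup m)
     (c v *: 'X_[m - mesym1 (supp x v)]) *: face_class v))@_m = c w.
Proof.
move=> wm.
have -> : restrict w (\sum_(v | supp x v == msup m)
     (c v *: 'X_[m - mesym1 (supp x v)]) *: face_class v) = c w *: 'X_[m].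
  rewrite (big_morph _ (restrictD simP labx w) (_ : restrict w 0 = 0)); last first.
    by apply: (addrI (restrict w 0)); rewrite -restrictD // !addr0.
  have sub v : supp x v == msup m -> msup (m - mesym1 (supp x v)) \subset supp x w.
    move=> /eqP vm; apply/subsetP => j; rewrite wm !inE mnmBE; by case: (m j).
  rewrite (bigD1 w) /=; last exact/eqP.
  rewrite big1 ?addr0 => [|v /andP[vm /eqP vw]].
    rewrite -mul_mpolyC -scalerA (restrictZ simP labx) (restrictX simP labx).
    rewrite sub; last exact/eqP.
    rewrite (restrict_class K simP labx) lexx -mpolyXD mul_mpolyC; congr (_ *: 'X_[_]).
    by apply/mnmP => j; rewrite mnmDE mnmBE !mnmE wm inE; case: (m j) => //= k; lia.
  rewrite -mul_mpolyC -scalerA (restrictZ simP labx) (restrictX simP labx).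
  rewrite sub // (restrict_class K simP labx); case: ifP => [vlw|_]; last by rewrite !mulr0.
  by case: vw; apply: (supp_inj simP labx vlw (lexx w)); rewrite wm (eqP vm).
by rewrite mcoeffZ mcoeffX eqxx mulr1.
Qed.

Lemma face_deg_eq m (u v : AP) : face_deg x (intdeg m) u -> face_deg x (intdeg m) v ->
  (forall w, supp x w = msup m -> (restrict w u)@_m = (restrict w v)@_m) -> u = v.
Proof.
move=> /standard_deg[a ->] /standard_deg[b ->] ab.
by apply: eq_bigr => w /eqP wm; have := ab w wm; rewrite !standard_coef // => ->.
Qed.

Lemma face_deg_exists m (c : P -> K) : exists2 u : AP, face_deg x (intdeg m) u
  & forall w, supp x w = msup m -> (restrict w u)@_m = c w.
Proof.
eexists; last by move=> w wm; exact: standard_coef.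
apply: big_ind => [|u v|w /eqP wm]; [exact: face_deg0 | exact: face_degD |].
rewrite -mul_mpolyC -scalerA; apply: face_degZ.
have := face_degX (m - mesym1 (supp x w)) (face_deg_class w).
rewrite -intdegD; congr (face_deg x (intdeg _) _).
by apply/mnmP => j; rewrite mnmDE mnmBE !mnmE wm inE; case: (m j) => //= k; lia.
Qed.

End HomogeneousPieces.

(** * The graded pieces of the localizations *)
Section LaurentCoefficient.
Variables (K : fieldType) (n : nat).
Implicit Types (p q : {mpoly K[n]}) (beta : {ffun 'I_n -> int}).

(** Extending coefficients by 0 to all integer exponents makes multiplication and
    division by a monomial mere shifts of beta. *)
Definition laurent_coef beta p : K :=
  if [forall j, 0 <= beta j] then p@_[multinom `|beta j|%N | j < n] else 0.

Lemma laurent_coef_intdeg m p : laurent_coef (intdeg m) p = p@_m.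
Proof.
rewrite /laurent_coef ifT; last by apply/forallP => j; rewrite ffunE.
by congr (_@__); apply/mnmP => j; rewrite mnmE ffunE absz_nat.
Qed.

Lemma laurent_coef_neg beta j p : beta j < 0 -> laurent_coef beta p = 0.
Proof.
move=> bj; rewrite /laurent_coef ifF //; apply/negP => /forallP/(_ j).
by rewrite leNgt bj.
Qed.

Lemma intdeg_or_neg beta : (exists m, beta = intdeg m) \/ (exists j, beta j < 0).
Proof.
case: (boolP [forall j, 0 <= beta j]) => [/forallP/intdegP|]; first by left.
by move=> /forallPn[j]; rewrite -ltNge; right; exists j.
Qed.

Lemma laurent_coefD beta p q :
  laurent_coef beta (p + q) = laurent_coef beta p + laurent_coef beta q.
Proof. by rewrite /laurent_coef; case: ifP; rewrite ?mcoeffD ?addr0. Qed.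

Lemma laurent_coefZ beta c p : laurent_coef beta (c%:MP * p) = c * laurent_coef beta p.
Proof. by rewrite /laurent_coef mul_mpolyC; case: ifP; rewrite ?mcoeffZ ?mulr0. Qed.

Lemma laurent_coef0 beta : laurent_coef beta 0 = 0.
Proof. by rewrite /laurent_coef mcoeff0 if_same. Qed.

Lemma laurent_coefX m beta p :
  laurent_coef (beta + intdeg m) ('X_[m] * p) = laurent_coef beta p.
Proof.
have [[b ->]|[j bj]] := intdeg_or_neg beta.
  by rewrite -intdegD !laurent_coef_intdeg mulrC addmC mcoeffMX.
rewrite (laurent_coef_neg _ bj).
have [[b bE]|[i bi]] := intdeg_or_neg (beta + intdeg m); last exact: laurent_coef_neg bi.
rewrite bE laurent_coef_intdeg; apply/eqP; rewrite mulrC mcoeff_eq0 (perm_mem (msuppMX _ _)).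
apply/mapP => -[m' _ bm]; move/ffunP: bE => /(_ j); rewrite bm !ffunE mnmDE => bE.
by move: (beta j) (m j) (m' j) bj bE => a c c'; lia.
Qed.

End LaurentCoefficient.

Section Localization.
Variables (K : fieldType) (d : Order.disp_t) (P : finBPOrderType d).
Variables (n : nat) (x : 'I_n -> P).
Hypothesis simP : simplicial_poset P.
Hypothesis labx : vertex_labeling x.

Local Notation AP := (@Defs_face_module__canonical__GRing_Lmodule K d P n x).
Local Notation restrict := (@restrict K d P n x).
Local Notation frac := Defs.frac.
Local Notation locF F := (loc AP (xprod K F)).
Local Notation loc_incl F G :=
  (@loc_map _ AP (xprod K F) (xprod K G) (xprod K (G :\: F))).
Implicit Types (F G : {set 'I_n}) (alpha beta : {ffun 'I_n -> int}).

Lemma xprodXn F k : xprod K F ^+ k = 'X_[mesym1 F *+ k].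
Proof. by rewrite xprodE mpolyXn. Qed.

Lemma xprod_setD F G : F \subset G -> xprod K G = xprod K F * xprod K (G :\: F).
Proof.
move=> FG; rewrite !xprodE -mpolyXD; congr ('X_[_]); apply/mnmP => j.
rewrite mnmDE !mnmE in_setD; have := subsetP FG j.
by case: (j \in F) => [->|_]; case: (j \in G).
Qed.

Lemma msup_mesym1n F k : msup (mesym1 F *+ k) \subset F.
Proof.
by apply/subsetP => j; rewrite inE mulmnE mnmE; case: (j \in F).
Qed.

(** The degree of x_F^k, by which the degrees of m and of m / x_F^k differ. *)
Definition shift F k : {ffun 'I_n -> int} := intdeg (mesym1 F *+ k).

Lemma shiftE F k j : shift F k j = (k * (j \in F))%N%:Z.
Proof. by rewrite ffunE mulmnE mnmE mulnC. Qed.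

Lemma add_shiftE alpha F k j : (alpha + shift F k) j = alpha j + (k * (j \in F))%N%:Z.
Proof. by rewrite ffunE shiftE. Qed.

Lemma shiftD F k l : shift F (k + l) = shift F k + shift F l.
Proof. by apply/ffunP => j; rewrite !ffunE !mulmnE mulnDr PoszD. Qed.

Lemma restrict_xprod w F k (u : AP) : F \subset supp x w ->
  restrict w (xprod K F ^+ k *: u) = 'X_[mesym1 F *+ k] * restrict w u.
Proof.
move=> Fw; rewrite xprodXn restrictX // ifT //.
exact: subset_trans (msup_mesym1n _ _) Fw.
Qed.

(** The coefficient of x^alpha in the Laurent polynomial obtained by restricting
    z to w.  This is meaningful when supp w contains F, since x_F then remains
    nonzero on w; by [coord_frac] it does not depend on the chosen fraction. *)
Definition coord (w : P) F alpha (z : locF F) : K :=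
  laurent_coef (alpha + shift F (denom z)) (restrict w (numer z)).

Lemma coord_frac w F alpha (m : AP) k : F \subset supp x w ->
  coord w alpha (frac (xprod K F) m k) = laurent_coef (alpha + shift F k) (restrict w m).
Proof.
move=> Fw; rewrite /coord; have [l] := numerP (xprod K F) m k.
set z := frac _ _ _; set d' := denom z => /(congr1 (restrict w)).
rewrite !restrict_xprod // => /(congr1 (laurent_coef (alpha + shift F (l + k + d')))).
rewrite {1}(_ : (l + k + d')%N = (k + (l + d'))%N); last by lia.
rewrite (_ : (l + k + d')%N = (d' + (l + k))%N); last by lia.
by rewrite !(shiftD _ _ (l + _)) !addrA !laurent_coefX.
Qed.

Lemma coordD w F alpha : F \subset supp x w -> {morph coord w alpha (F := F) : y z / y + z}.
Proof.
move=> Fw y z; rewrite -[y]fracK -[z]fracK fracD !coord_frac // restrictD //.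
rewrite laurent_coefD !restrict_xprod //; congr (_ + _).
  by rewrite shiftD addrA laurent_coefX.
by rewrite addnC shiftD addrA laurent_coefX.
Qed.

Lemma coord0 w F alpha : F \subset supp x w -> coord w alpha (0 : locF F) = 0.
Proof.
by move=> Fw; apply: (addrI (coord w alpha (0 : locF F))); rewrite -coordD // !addr0.
Qed.

Lemma coordZ w F alpha (c : K) z : F \subset supp x w ->
  coord w alpha (c%:MP *: z : locF F) = c * coord w alpha z.
Proof.
by move=> Fw; rewrite -[z]fracK fracZ !coord_frac // restrictZ // laurent_coefZ.
Qed.

Lemma coordX w F alpha m z : F \subset supp x w ->
  coord w (alpha + intdeg m) ('X_[m] *: z : locF F) =
  if msup m \subset supp x w then coord w alpha z else 0.
Proof.
move=> Fw; rewrite -[z]fracK fracZ !coord_frac // restrictX //.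
by case: ifP => _; rewrite ?laurent_coef0 // addrAC laurent_coefX.
Qed.

Lemma coord_loc_map w F G alpha z : F \subset G -> G \subset supp x w ->
  coord w alpha (loc_incl F G z) = coord w alpha z.
Proof.
move=> FG Gw; have Fw := subset_trans FG Gw.
rewrite -[z]fracK (loc_map_frac (xprod_setD FG)) !coord_frac // restrict_xprod; last first.
  exact: subset_trans (subsetDl _ _) Gw.
rewrite -[RHS](laurent_coefX (mesym1 (G :\: F) *+ denom z)) -addrA.
congr (laurent_coef (_ + _) _).
rewrite /shift -intdegD; congr intdeg; apply/mnmP => j.
rewrite mnmDE !mulmnE !mnmE in_setD -mulnDl; have := subsetP FG j.
by case: (j \in F) => [->|_]; case: (j \in G).
Qed.

(** The coordinates only involve monomials of degree alpha + shift F k.  Their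
    support is in supp u, because F is and alpha is nonpositive elsewhere, so
    [restrict_coef_le] applies. *)
Lemma coord_le u w F alpha z : (u <= w)%O -> F \subset supp x u ->
    (forall j, j \notin supp x u -> alpha j <= 0) ->
  coord u alpha (z : locF F) = coord w alpha z.
Proof.
move=> uw Fu a0; rewrite /coord.
have [[b bE]|[i bi]] := intdeg_or_neg (alpha + shift F (denom z)); last first.
  by rewrite !(laurent_coef_neg _ bi).
rewrite bE !laurent_coef_intdeg; apply: (restrict_coef_le simP labx) => //.
apply/subsetP => j; rewrite inE; apply: contraR => ju.
have jF : j \in F = false by apply: contraNF ju; apply: (subsetP Fu).
move/ffunP: bE => /(_ j); rewrite add_shiftE jF muln0 addr0 ffunE => bj.
by have := a0 j ju; rewrite bj; lia.
Qed.

Lemma coord_neg w F alpha j (z : locF F) : alpha j < 0 -> j \notin F -> coord w alpha z = 0.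
Proof.
move=> aj jF; rewrite /coord (laurent_coef_neg (j := j)) //.
by rewrite add_shiftE (negPf jF) muln0 addr0.
Qed.

Local Notation loc_homog := (loc_deg (face_deg x)).

Lemma loc_degP F alpha (z : locF F) : loc_homog alpha z <->
  exists k (m : AP), z = frac (xprod K F) m k /\ face_deg x (alpha + shift F k) m.
Proof.
have E k : alpha + shift F k = [ffun j => alpha j + (k * (j \in F))%N%:Z].
  by apply/ffunP => j; rewrite add_shiftE ffunE.
by split=> -[k [m [zE mD]]]; exists k, m; rewrite E in mD *.
Qed.

Lemma loc_deg0 F alpha : loc_homog alpha (0 : locF F).
Proof. by apply/loc_degP; exists 0%N, 0; split=> //; apply: face_deg0. Qed.

Lemma loc_degD F alpha (y z : locF F) :
  loc_homog alpha y -> loc_homog alpha z -> loc_homog alpha (y + z).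
Proof.
move=> /loc_degP[k [m [-> mD]]] /loc_degP[l [m' [-> mD']]]; rewrite fracD.
apply/loc_degP; do 2!eexists; split; first by [].
apply: face_degD; rewrite xprodXn shiftD addrA.
  exact: (face_degX simP labx).
by rewrite addrAC; exact: (face_degX simP labx).
Qed.

Lemma loc_degZ F alpha (c : K) (z : locF F) :
  loc_homog alpha z -> loc_homog alpha (c%:MP *: z).
Proof.
move=> /loc_degP[k [m [-> mD]]]; rewrite fracZ.
by apply/loc_degP; do 2!eexists; split; first by []; exact: face_degZ.
Qed.

Lemma loc_degX F alpha m (z : locF F) :
  loc_homog alpha z -> loc_homog (alpha + intdeg m) ('X_[m] *: z).
Proof.
move=> /loc_degP[k [u [-> uD]]]; rewrite fracZ.
apply/loc_degP; do 2!eexists; split; first by [].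
by rewrite addrAC; exact: (face_degX simP labx).
Qed.

Lemma loc_deg_map F G alpha z : F \subset G ->
  loc_homog alpha z -> loc_homog alpha (loc_incl F G z).
Proof.
move=> FG /loc_degP[k [m [-> mD]]]; rewrite (loc_map_frac (xprod_setD FG)).
apply/loc_degP; do 2!eexists; split; first by [].
have -> : shift G k = shift F k + intdeg (mesym1 (G :\: F) *+ k).
  rewrite /shift -intdegD; congr intdeg; apply/mnmP => j.
  rewrite mnmDE !mulmnE !mnmE in_setD -mulnDl; have := subsetP FG j.
  by case: (j \in F) => [->|_]; case: (j \in G).
by rewrite xprodXn addrA; exact: (face_degX simP labx).
Qed.

Lemma large_shift F alpha : exists l, forall j, j \in F -> 0 < (alpha + shift F l) j.
Proof.
exists (\sum_j `|alpha j|).+1%N => j jF; rewrite add_shiftE jF muln1.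
rewrite (bigD1 j) //=; lia.
Qed.

Lemma shift_supp F alpha k b : (forall j, j \in F -> 0 < (alpha + shift F k) j) ->
  alpha + shift F k = intdeg b -> msup b = F :|: degree_supp alpha.
Proof.
move=> Fpos bE; apply/setP => j; rewrite !inE; move/ffunP: bE => /(_ j).
have := Fpos j; rewrite !ffunE mulmnE mnmE; case: (j \in F) => /= [/(_ isT)|_]; lia.
Qed.

(** Enlarging the denominator makes the degree of the numerator positive on F, so
    that its support is F :|: supp alpha; then the numerator is determined by its
    coefficients on the faces with this support. *)
Lemma coord_inj F alpha (y z : locF F) : loc_homog alpha y -> loc_homog alpha z ->
    (forall w, supp x w = F :|: degree_supp alpha -> coord w alpha y = coord w alpha z) ->
  y = z.
Proof.
move=> yD zD yz; apply/eqP; rewrite -subr_eq0; apply/eqP.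
have cyz w : supp x w = F :|: degree_supp alpha -> coord w alpha (y - z) = 0.
  move=> sw; have Fw : F \subset supp x w by rewrite sw subsetUl.
  have -> : y - z = y + (-1)%:MP *: z by rewrite mpolyCN scaleN1r.
  by rewrite coordD // coordZ // yz // mulN1r subrr.
have : loc_homog alpha (y - z).
  have -> : y - z = y + (-1)%:MP *: z by rewrite mpolyCN scaleN1r.
  exact/loc_degD/loc_degZ.
move: {y z yD zD yz}(y - z) cyz => z cz /loc_degP[k [m [zE mD]]].
(* The numerator is replaced by its multiple of degree positive on F. *)
have [l lP] := large_shift F (alpha + shift F k).
have {}lP j : j \in F -> 0 < (alpha + shift F (k + l)) j.
  by rewrite shiftD addrA; apply: lP.
have zE' : z = frac (xprod K F) (xprod K F ^+ l *: m) (k + l).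
  by rewrite zE; apply/fracP; exists 0%N; rewrite !add0n scalerA -exprD.
have mD' : face_deg x (alpha + shift F (k + l)) (xprod K F ^+ l *: m : AP).
  by rewrite xprodXn shiftD addrA; exact: (face_degX simP labx).
suff m0 : xprod K F ^+ l *: m = 0.
  by rewrite zE' m0; apply/fracP; exists 0%N; rewrite !scaler0.
have [[b bE]|[j bj]] := intdeg_or_neg (alpha + shift F (k + l)); last first.
  exact: (face_deg_neg mD' bj).
rewrite bE in mD'; apply: (face_deg_eq simP labx mD'); first exact: face_deg0.
move=> w; rewrite (shift_supp lP bE) => sw.
have r0 : restrict w 0 = 0.
  by apply: (addrI (restrict w 0)); rewrite -restrictD // !addr0.
by have := cz w sw; rewrite zE' coord_frac ?sw ?subsetUl // bE laurent_coef_intdeg r0 mcoeff0.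
Qed.

Lemma loc_deg_eq0 F alpha j (z : locF F) : loc_homog alpha z ->
  alpha j < 0 -> j \notin F -> z = 0.
Proof.
move=> zD aj jF; apply: (coord_inj zD (loc_deg0 _ _)) => w sw.
by rewrite coord0 ?sw ?subsetUl // (coord_neg _ _ aj).
Qed.

Lemma coord_exists F alpha (c : P -> K) : (forall j, j \notin F -> 0 <= alpha j) ->
  exists2 z : locF F, loc_homog alpha z
    & forall w, supp x w = F :|: degree_supp alpha -> coord w alpha z = c w.
Proof.
move=> a0; have [l lP] := large_shift F alpha.
have [j|b bE] := @intdegP _ (alpha + shift F l).
  case: (boolP (j \in F)) => jF; first exact/ltW/lP.
  by rewrite add_shiftE (negPf jF) muln0 addr0 a0.
have [u uD uc] := face_deg_exists simP labx b c.
exists (frac (xprod K F) u l); first by apply/loc_degP; exists l, u; rewrite bE.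
move=> w sw; rewrite coord_frac ?sw ?subsetUl // bE laurent_coef_intdeg uc //.
by rewrite (shift_supp lP bE).
Qed.

Lemma loc_incl0 F G : F \subset G -> loc_incl F G (0 : locF F) = 0.
Proof.
move=> FG.
have := loc_map_frac (xprod_setD FG) (0 : AP) 0.
by rewrite scaler0.
Qed.

(** If alpha_j > 0, then j already belongs to supp alpha, so inverting x_j does
    not change the faces that index the coordinates in degree alpha. *)
Section PositiveEntry.
Variables (F : {set 'I_n}) (alpha : {ffun 'I_n -> int}) (j : 'I_n).
Hypothesis aj : 0 < alpha j.

Let suppE : (j |: F) :|: degree_supp alpha = F :|: degree_supp alpha.
Proof.
apply/setP => i; rewrite !inE; case: eqP => // ->.
by rewrite (gt_eqF aj) !orbT.
Qed.

Lemma loc_incl_inj y z : loc_homog alpha y -> loc_homog alpha z ->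
  loc_incl F (j |: F) y = loc_incl F (j |: F) z -> y = z.
Proof.
move=> yD zD yz; apply: (coord_inj yD zD) => w sw.
have sFj := subsetUr [set j] F.
have Gw : j |: F \subset supp x w by rewrite sw -suppE subsetUl.
by rewrite -(coord_loc_map alpha y sFj Gw) yz coord_loc_map.
Qed.

Lemma loc_incl_surj z : loc_homog alpha z ->
  exists2 y, loc_homog alpha y & loc_incl F (j |: F) y = z.
Proof.
move=> zD; have sFj := subsetUr [set j] F.
case: (boolP [forall i, (i \notin F) ==> (0 <= alpha i)]) => [/forall_inP a0|].
  have [y yD yc] := coord_exists (fun w => coord w alpha z) a0; exists y => //.
  apply: coord_inj zD _ => [|w sw]; first exact: loc_deg_map.
  have Gw : j |: F \subset supp x w by rewrite sw subsetUl.
  by rewrite coord_loc_map // yc // sw suppE.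
move=> /forall_inPn[i iF]; rewrite -ltNge => ai.
exists 0; first exact: loc_deg0.
have -> : z = 0.
  apply: (loc_deg_eq0 zD ai); rewrite in_setU1 negb_or [i \notin F]iF andbT.
  by apply: contraTneq ai => ->; rewrite -leNgt ltW.
exact: loc_incl0.
Qed.

End PositiveEntry.

End Localization.

(** * Cohomology classes and the Cech complex *)
Section Coclass.
Variables (R : nzRingType) (U V W : lmodType R).
Variables (f : {linear U -> V}) (g : {linear V -> W}).

Lemma coclassP (a : R) u v : g u = 0 -> g v = 0 ->
  coclass f g (a *: u + v) = a *: coclass f g u + coclass f g v.
Proof.
move=> /eqP gu /eqP gv.
rewrite -[u](SubK (cocycle g) gu) -[v](SubK (cocycle g) gv) -linearP !coclassE.
exact: linearP.
Qed.

Lemma coclass0 : coclass f g 0 = 0.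
Proof.
have := coclassP 1 (linear0 g) (linear0 g); rewrite !scale1r addr0.
by rewrite -{1}[coclass f g 0]addr0 => /addrI.
Qed.

Lemma coclassZ a u : g u = 0 -> coclass f g (a *: u) = a *: coclass f g u.
Proof.
by move=> gu; rewrite -[a *: u]addr0 coclassP ?linear0 // coclass0 addr0.
Qed.

Lemma coclass_sum (I : Type) (r : seq I) (Q : pred I) (F : I -> V) :
    (forall i, Q i -> g (F i) = 0) ->
  coclass f g (\sum_(i <- r | Q i) F i) = \sum_(i <- r | Q i) coclass f g (F i).
Proof.
move=> gF; elim: r => [|i r IH]; first by rewrite !big_nil coclass0.
rewrite !big_cons; case: ifP => // Qi.
rewrite -[F i]scale1r coclassP ?gF // ?scale1r ?IH //.
by rewrite linear_sum big1.
Qed.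

Lemma coclass_eq0 u : g u = 0 -> coclass f g u = 0 <-> exists w, f w = u.
Proof.
move=> gu; have := coclass_eq f gu (linear0 g); rewrite coclass0 => ->.
by rewrite subr0.
Qed.

End Coclass.

Lemma sum_sub (V : nmodType) (T : finType) (p : pred T) (F : T -> V) :
  \sum_(y : {y | p y}) F (val y) = \sum_(y | p y) F y.
Proof.
rewrite [RHS](reindex_omap (val : {y | p y} -> T) insub) => [|y py].
  by apply: eq_bigl => y; rewrite valK eqxx (valP y).
by rewrite insubT.
Qed.

(** The exponent of the Cech sign for the inclusion of G :\ a in G. *)
Definition position n (a : 'I_n) (G : {set 'I_n}) : nat := #|[set b in G | (b < a)%N]|.

Lemma cech_sign_setD1 n (G : {set 'I_n}) a : a \in G ->
  cech_sign (G :\ a) G = position a G.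
Proof.
move=> aG; apply: eq_card => b; rewrite !inE.
apply/andP/andP => [[/andP[ba bG] /exists_inP[c]]|[bG ba]].
  rewrite bG => cD bc; split=> //; move: cD bc.
  by rewrite !inE => /andP[+ cG]; rewrite cG andbT negbK => /eqP ->.
split; first by rewrite bG andbT; apply: contraTneq ba => ->; rewrite ltnn.
by apply/exists_inP; exists a; rewrite // !inE eqxx aG.
Qed.

Lemma position_setU1 n (G : {set 'I_n}) a j : j \notin G ->
  position a (j |: G) = (position a G + (j < a))%N.
Proof.
move=> jG; rewrite /position.
have -> : [set b in j |: G | (b < a)%N] =
    if (j < a)%N then j |: [set b in G | (b < a)%N] else [set b in G | (b < a)%N].
  apply/setP => b; case: ifP => ja; rewrite !inE; last first.
    by case: eqP => //= ->; rewrite ja !andbF.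
  by case: eqP => //= ->.
case: ifP => _; last by rewrite addn0.
by rewrite cardsU1 inE (negPf jG) addnC.
Qed.

Section Cech.
Variables (K : fieldType) (d : Order.disp_t) (P : finBPOrderType d).
Variables (n : nat) (x : 'I_n -> P).
Hypothesis simP : simplicial_poset P.
Hypothesis labx : vertex_labeling x.

Local Notation AP := (@Defs_face_module__canonical__GRing_Lmodule K d P n x).
Local Notation locF F := (loc AP (xprod K F)).
Local Notation loc_incl F G :=
  (@loc_map _ AP (xprod K F) (xprod K G) (xprod K (G :\: F))).
Local Notation loc_homog := (loc_deg (face_deg x)).
Local Notation cech_homog := (cech_deg (face_deg x)).
Implicit Types (F G : {set 'I_n}) (alpha beta : {ffun 'I_n -> int}) (i j : int).

(** The components of a Cech cochain, extended by 0 to the sets of the wrong size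
    so that they can be indexed by arbitrary sets. *)
Definition cech_at i (c : cech AP i) F : locF F :=
  if @idP (#|F|%:Z == i) is ReflectT Fi then c (exist _ F Fi) else 0.

Lemma cech_at_val i (c : cech AP i) (F : face_idx n i) : cech_at c (val F) = c F.
Proof.
rewrite /cech_at; case: F => F Fi /=; case: {-}_ / idP => [Fi'|/(_ Fi)//].
by rewrite (bool_irrelevance Fi' Fi).
Qed.

Lemma cech_at_out i (c : cech AP i) F : #|F|%:Z != i -> cech_at c F = 0.
Proof. by move=> Fi; rewrite /cech_at; case: {-}_ / idP => // Fi'; case/negP: Fi. Qed.

Lemma cech_atD i (c c' : cech AP i) F : cech_at (c + c') F = cech_at c F + cech_at c' F.
Proof. by rewrite /cech_at; case: {-}_ / idP => // _; rewrite addr0. Qed.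

Lemma cech_atZ i a (c : cech AP i) F : cech_at (a *: c) F = a *: cech_at c F.
Proof. by rewrite /cech_at; case: {-}_ / idP => // _; rewrite scaler0. Qed.

Lemma cech_at0 i F : cech_at (0 : cech AP i) F = 0.
Proof. by rewrite /cech_at; case: {-}_ / idP. Qed.

Lemma cech_ext i (c c' : cech AP i) :
  (forall F, #|F|%:Z = i -> cech_at c F = cech_at c' F) -> c = c'.
Proof.
move=> cc; apply/functional_extensionality_dep => F.
by rewrite -!cech_at_val cc //; apply/eqP; exact: (valP F).
Qed.

Lemma cech_exists i (Q : forall F, locF F -> Prop) : (forall F, exists z : locF F, Q F z) ->
  exists c : cech AP i, forall F, #|F|%:Z = i -> Q F (cech_at c F).
Proof.
move=> exQ; exists (fun F : face_idx n i => sval (cid (exQ (val F)))) => F /eqP Fi.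
rewrite (cech_at_val _ (exist _ F Fi : face_idx n i)).
exact: (svalP (cid (exQ F))).
Qed.

Lemma cech_degP i alpha (c : cech AP i) : cech_homog alpha c <->
  forall F, loc_homog alpha (cech_at c F).
Proof.
split=> cD F; last by rewrite -cech_at_val.
case: (boolP (#|F|%:Z == i)) => [Fi|Fi]; last by rewrite cech_at_out //; apply: loc_deg0.
by rewrite (cech_at_val _ (exist _ F Fi : face_idx n i)); exact: (cD (exist _ F Fi)).
Qed.

Lemma loc_incl_sum F G (I : Type) (r : seq I) (Q : pred I) (z : I -> locF F) : F \subset G ->
  loc_incl F G (\sum_(i <- r | Q i) z i) = \sum_(i <- r | Q i) loc_incl F G (z i).
Proof.
move=> FG; have L := loc_map_linear (M := AP) (xprod_setD K FG).
apply: (big_morph _ (id1 := 0) (op1 := +%R)) => [u v|].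
  by have := L 1 u v; rewrite !scale1r.
exact: loc_incl0.
Qed.

Lemma loc_inclZ F G a (z : locF F) : F \subset G ->
  loc_incl F G (a *: z) = a *: loc_incl F G z.
Proof.
move=> FG; rewrite -[z]fracK fracZ !(loc_map_frac (xprod_setD K FG)) fracZ.
by rewrite scaler_swap.
Qed.

Lemma loc_incl_comp F G (H : {set 'I_n}) (z : locF F) : F \subset G -> G \subset H ->
  loc_incl G H (loc_incl F G z) = loc_incl F H z.
Proof.
move=> FG GH; have FH := subset_trans FG GH.
rewrite -[z]fracK !loc_map_frac; try exact: xprod_setD.
congr (Defs.frac _ _ _); rewrite scalerA -exprMn; congr (_ ^+ _ *: _).
rewrite !xprodE -mpolyXD; congr ('X_[_]); apply/mnmP => j.
rewrite mnmDE !mnmE !in_setD; have := subsetP FG j; have := subsetP GH j.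
case: (j \in F) => [GHj ->|GHj _] //=.
by case: (j \in G) GHj => [->|_] //; case: (j \in H).
Qed.

Lemma cech_dE i j (c : cech AP i) G : i + 1 = j -> #|G|%:Z = j ->
  cech_at (cech_d c : cech AP j) G = \sum_(a in G)
    (-1) ^+ position a G *: loc_incl (G :\ a) G (cech_at c (G :\ a)).
Proof.
move=> ij Gj; have Gj' := introT eqP Gj.
rewrite (cech_at_val _ (exist _ G Gj' : face_idx n j)) /cech_d /=.
transitivity (\sum_(F : face_idx n i | val F \subset G) (-1) ^+ cech_sign (val F) G
    *: loc_incl (val F) G (cech_at c (val F))).
  by apply: eq_bigr => F _; rewrite cech_at_val.
rewrite big_mkcond (sum_sub (fun F : {set 'I_n} => #|F|%:Z == i) (fun F => if F \subset G then
  (-1) ^+ cech_sign F G *: loc_incl F G (cech_at c F) else 0)) -big_mkcondr /=.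
rewrite (eq_bigl (mem [set G :\ a | a in G])) => [|F].
  rewrite big_imset => [|a b aG bG /setP/(_ a)]; last first.
    by rewrite !inE eqxx aG andbT; case: eqP.
  by apply: eq_bigr => a aG; rewrite cech_sign_setD1.
apply/andP/imsetP => [[/eqP Fi FG]|[a aG ->]].
  have : #|G :\: F| = 1%N.
    have /esym := cardsID F G; rewrite (setIidPr FG).
    by move: #|G :\: F| #|F| #|G| Gj Fi ij => u v w; lia.
  move=> /eqP/cards1P[a GF]; exists a; first by have := set11 a; rewrite -GF inE => /andP[].
  by rewrite -GF setDDr setDv set0U (setIidPr FG).
split; last exact: subsetDl.
by move: Gj; rewrite (cardsD1 a G) aG -ij; move: #|_| => u; lia.
Qed.

End Cech.

(** * Exactness in degrees with a positive entry *)
Section Vanish.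
Variables (K : fieldType) (d : Order.disp_t) (P : finBPOrderType d).
Variables (n : nat) (x : 'I_n -> P).
Hypothesis simP : simplicial_poset P.
Hypothesis labx : vertex_labeling x.

Local Notation AP := (@Defs_face_module__canonical__GRing_Lmodule K d P n x).
Local Notation locF F := (loc AP (xprod K F)).
Local Notation loc_incl F G :=
  (@loc_map _ AP (xprod K F) (xprod K G) (xprod K (G :\: F))).
Local Notation loc_homog := (loc_deg (face_deg x)).
Local Notation cech_homog := (cech_deg (face_deg x)).
Implicit Types (F G : {set 'I_n}) (alpha beta : {ffun 'I_n -> int}) (i j : int).


Lemma sign_mpolyC k : ((-1) ^+ k : {mpoly K[n]}) = ((-1) ^+ k)%:MP.
Proof. by rewrite rmorphXn /= mpolyCN. Qed.

Lemma signrK (V : lmodType {mpoly K[n]}) k (z : V) : (-1) ^+ k *: ((-1) ^+ k *: z) = z.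
Proof. by rewrite scalerA -exprMn mulrNN mulr1 expr1n scale1r. Qed.

(** The cochain b is the contracting homotopy applied to c: its component at F is
    0 if j is in F, and otherwise is the signed preimage of the component of c at
    j |: F.  At the sets containing j only one term of the differential of b is
    nonzero, and gives c back.  At the other sets G, the equality is tested after
    inverting x_j as well, where it becomes the vanishing of the differential of
    c at j |: G. *)
Lemma cech_homog_exact i alpha (j : 'I_n) (c : cech AP i) :
    0 < alpha j -> cech_homog alpha c -> cech_d c = 0 :> cech AP (i + 1) ->
  exists b : cech AP (i - 1), cech_d b = c.
Proof.
move=> aj /cech_degP cD dc.
pose Q F (y : locF F) := loc_homog alpha y /\ if j \in F then y = 0 else
  loc_incl F (j |: F) y = (-1) ^+ position j (j |: F) *: cech_at c (j |: F).
have [|b bP] := @cech_exists _ _ _ _ x (i - 1) Q.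
  move=> F; rewrite /Q; have [jF|jF] := boolP (j \in F).
    by exists 0; split=> [|//]; exact: (@loc_deg0 K d P n x F alpha).
  have [|y yD yE] := @loc_incl_surj K d P n x simP labx F alpha j aj
     ((-1) ^+ position j (j |: F) *: cech_at c (j |: F)); last by exists y.
  by rewrite sign_mpolyC; apply: loc_degZ.
have ii : i - 1 + 1 = i by rewrite subrK.
exists b; apply: cech_ext => G Gi; rewrite (cech_dE b ii Gi).
have Gcard a : a \in G -> #|G :\ a|%:Z = i - 1.
  by move=> aG; rewrite -Gi (cardsD1 a G) aG; move: #|_| => u; lia.
case: (boolP (j \in G)) => jG.
  rewrite (bigD1 j jG) /= big1 => [|a /andP[aG aj']]; last first.
    have [_] := bP _ (Gcard a aG); rewrite in_setD1 eq_sym aj' jG => ->.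
    by rewrite loc_incl0 ?subsetDl // scaler0.
  have [_] := bP _ (Gcard j jG); rewrite setD11 setD1K // => ->.
  by rewrite signrK addr0.
set H := j |: G; have GH : G \subset H := subsetUr _ _.
have HE a : a \in G -> H :\ a = j |: (G :\ a).
  move=> aG; apply/setP => e; rewrite !inE; have [->|//] := eqVneq e j.
  by rewrite andbT orTb; apply: contraNneq jG => ->.
have termE a : a \in G -> loc_incl G H ((-1) ^+ position a G *:
      loc_incl (G :\ a) G (cech_at b (G :\ a))) =
    - ((-1) ^+ position j H *:
       ((-1) ^+ position a H *: loc_incl (H :\ a) H (cech_at c (H :\ a)))).
  move=> aG; have [_] := bP _ (Gcard a aG).
  rewrite in_setD1 (negPf jG) andbF => bE.
  rewrite loc_inclZ // loc_incl_comp ?subsetDl //.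
  rewrite -(@loc_incl_comp _ _ _ _ _ (G :\ a) (j |: (G :\ a)) H); last 2 first.
  - exact: subsetUr.
  - by rewrite -HE // subsetDl.
  rewrite bE -HE // loc_inclZ ?subsetDl // scalerA scalerA -scaleNr.
  congr (_ *: _); rewrite -!exprD -[RHS]mulN1r -exprS.
  have pH : position j H = (position j (H :\ a) + (a < j))%N.
    by rewrite -position_setU1 ?setD1K // ?inE ?eqxx // aG orbT.
  have pG : position a H = (position a G + (j < a))%N by rewrite position_setU1.
  have aj' : (a < j)%N + (j < a)%N = 1%N :> nat.
    by case: (ltngtP a j) => // /val_inj aE; move: jG; rewrite -aE aG.
  (* Exactly one of the two positions grows when a, respectively j, is added. *)
  rewrite pH pG -[LHS]signr_odd -[RHS]signr_odd; congr ((-1) ^+ nat_of_bool _).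
  by move: (position a G) (position j _) (a < j)%N (j < a)%N aj' => u v [] [] //=; lia.
apply: (@loc_incl_inj K d P n x simP labx G alpha j aj) => //.
  apply: (big_ind (loc_homog alpha)) => [|u v|a aG].
  - exact: loc_deg0.
  - exact: loc_degD.
  rewrite sign_mpolyC; apply: loc_degZ; apply: loc_deg_map; rewrite ?subsetDl //.
  by have [] := bP _ (Gcard a aG).
rewrite loc_incl_sum // (eq_bigr _ termE) sumrN -scaler_sumr.
have Hi : #|H|%:Z = i + 1 by rewrite cardsU1 jG -Gi; move: #|_| => u; lia.
have := cech_dE c erefl Hi; rewrite dc cech_at0 big_setU1 // [in H :\ j]setU1K //.
move/esym => /= /eqP; rewrite addrC addr_eq0 => /eqP ->.
by rewrite scalerN opprK signrK.
Qed.

End Vanish.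

(** * The Cech complex in nonpositive degrees *)
Section OrientationSign.
Variables (n : nat) (O : rel 'I_n).

Definition concordant_pairs (S : {set 'I_n}) : nat :=
  (\sum_(a in S) \sum_(b in S) ((a < b)%N && O a b))%N.

(** For k in T the comparisons of j and k in the two orders contribute to the
    two sides an even number of times in total, because the pair is concordant
    exactly when j < k and O j k are both true or both false. *)
Lemma concordant_pairs_setU1 (T : {set 'I_n}) j : j \notin T ->
    {in T, forall k, O k j = ~~ O j k} ->
  odd (concordant_pairs (j |: T)) =
  odd (concordant_pairs T + #|[set k in T | O j k]| + position j T).
Proof.
move=> jT Oj; rewrite /concordant_pairs big_setU1 //= big_setU1 //= ltnn add0n.
under [X in (_ + X)%N]eq_bigr do rewrite big_setU1 //=.
rewrite big_split /= /position.
have cardE (Q : pred 'I_n) : #|[set k in T | Q k]| = (\sum_(k in T) Q k)%N.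
  rewrite -sum1_card big_mkcond [RHS]big_mkcond; apply: eq_bigr => k _.
  by rewrite inE; case: (k \in T) => //=; case: (Q k).
rewrite !cardE; set X := (\sum_(a in T) \sum_(b in T) _)%N.
have : odd (\sum_(k in T) ((j < k)%N && O j k) + \sum_(k in T) ((k < j)%N && O k j)
    + \sum_(k in T) O j k + \sum_(k in T) (k < j)%N) = false.
  rewrite -!big_split /=; apply/negbTE; rewrite -dvdn2; apply: dvdn_sum => k kT.
  have kj : k != j by apply: contraNneq jT => <-.
  by rewrite Oj //; move: kj; rewrite -val_eqE /=; case: ltngtP; case: (O j k).
rewrite !oddD; do 5!case: odd; by [].
Qed.

End OrientationSign.

Section Comparison.
Variables (K : fieldType) (d : Order.disp_t) (P : finBPOrderType d).
Variables (n : nat) (x : 'I_n -> P).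
Hypothesis simP : simplicial_poset P.
Hypothesis labx : vertex_labeling x.

Local Notation AP := (@Defs_face_module__canonical__GRing_Lmodule K d P n x).
Local Notation locF F := (loc AP (xprod K F)).
Local Notation loc_incl F G :=
  (@loc_map _ AP (xprod K F) (xprod K G) (xprod K (G :\: F))).
Local Notation loc_homog := (loc_deg (face_deg x)).
Local Notation cech_homog := (cech_deg (face_deg x)).
Implicit Types (F G : {set 'I_n}) (alpha beta : {ffun 'I_n -> int}).


Variable O : rel 'I_n.
Hypothesis orO : orientation x O.

Lemma supp_remove z j : j \in supp x z -> supp x (remove_vertex x z j) = supp x z :\ j.
Proof. by move=> jz; have [] := remove_vertexP simP labx jz. Qed.

Definition orient_sign (y : P) : K := (-1) ^+ concordant_pairs O (supp x y).

Lemma orient_signK y : orient_sign y * orient_sign y = 1.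
Proof. by rewrite -exprD addnn -signr_odd odd_double expr0. Qed.

(** Multiplying each basis element y by orient_sign y turns the signs of the
    coboundary into those of the Cech differential. *)
Lemma orient_sign_remove z j : j \in supp x z ->
  orient_sign (remove_vertex x z j) *
    (-1) ^+ coboundary_exponent x O j (remove_vertex x z j) =
  orient_sign z * (-1) ^+ position j (supp x z).
Proof.
move=> jz; rewrite /orient_sign /coboundary_exponent supp_remove //.
have [Or Oa _ Ot] := orO.
set T := supp x z :\ j; have jT : j \notin T by rewrite setD11.
have zE : supp x z = j |: T by rewrite setD1K.
have -> : [set k in T | O j k && (j != k)] = [set k in T | O j k].
  apply/setP => k; rewrite !inE; case: (boolP (k == j)) => //= kj.
  by rewrite eq_sym kj andbT.
have Oj : {in T, forall k, O k j = ~~ O j k}.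
  move=> k; rewrite !inE => /andP[kj kz].
  have : O k j || O j k by apply: (Ot z); rewrite // inE.
  case: (boolP (O j k)) => [Ojk _|_]; last by rewrite orbF => ->.
  by apply/negbTE; apply: contra kj => Okj; apply/eqP/Oa; rewrite Okj.
have pE : position j (supp x z) = position j T.
  by rewrite zE position_setU1 // ltnn addn0.
rewrite pE -!exprD -[LHS]signr_odd -[RHS]signr_odd {1}zE.
rewrite [in RHS]oddD concordant_pairs_setU1 // !oddD.
by do 3!case: odd.
Qed.

Section NonpositiveDegree.
Variable alpha : {ffun 'I_n -> int}.
Hypothesis alpha0 : nonpositive alpha.

Let S := degree_supp alpha.

(** The component at w of the projection of the Cech complex onto its part of
    degree alpha, written in the basis of faces above w. *)
Definition cech_restrict (w : P) i k (c : cech AP i) : cochain K (contrastar w) k :=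
  [ffun y => orient_sign (val y) * coord (val y) alpha (cech_at c (supp x (val y)))].

Lemma cech_restrict_linear w i k (a : K) (c c' : cech AP i) :
  cech_restrict w k (a%:MP *: c + c') = a *: cech_restrict w k c + cech_restrict w k c'.
Proof.
apply/ffunP => y; rewrite !ffunE cech_atD cech_atZ coordD // coordZ // mulrDr.
by rewrite mulrCA.
Qed.

Lemma cech_restrict_val w i k (c : cech AP i) y :
  oapp (cech_restrict w k c) 0 (insub y) =
  if (w <= y)%O && ((rank y)%:Z == k + 1)
  then orient_sign y * coord y alpha (cech_at c (supp x y)) else 0.
Proof.
case: insubP => [z|]; rewrite inE negbK.
  by move=> -> <- /=; rewrite ffunE.
by move=> /negPf ->.
Qed.

Lemma alpha_le0 j : alpha j <= 0. Proof. exact: (forallP alpha0). Qed.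

(** At a face z above w both sides are sums over the vertices x_a of z of the
    coordinate of c at z without x_a, with signs matched by [orient_sign_remove].
    If z without x_a is not above w, then alpha_a < 0, and this coordinate is 0
    since x_a is not inverted there. *)
Lemma cech_restrict_d w i j k l (c : cech AP i) : supp x w = S ->
    i + 1 = j -> k + 1 = i -> l + 1 = j ->
  coboundary x O l (cech_restrict w k c) = cech_restrict w l (cech_d c : cech AP j).
Proof.
move=> wS ij ki lj; apply/ffunP => z; rewrite coboundaryE ffunE.
have /andP[] := valP z; rewrite inE negbK (rank_supp simP labx) => wz /eqP zl.
move: (val z) wz zl => {}z wz zl.
under eq_bigr do rewrite /= cech_restrict_val mulr_sumr.
rewrite (exchange_big_dep predT) //= [RHS](_ : _ = \sum_(a in supp x z)
    orient_sign z * (-1) ^+ position a (supp x z)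
      * coord (remove_vertex x z a) alpha (cech_at c (supp x z :\ a))); last first.
  rewrite cech_dE // -?lj //.
  rewrite (big_morph (coord z alpha (F := supp x z)) (id1 := 0) (op1 := +%R)); last 2 first.
  - exact: coordD.
  - exact: coord0.
  rewrite mulr_sumr; apply: eq_bigr => a az; rewrite sign_mpolyC coordZ // mulrA.
  congr (_ * _).
  apply: etrans (coord_loc_map simP labx alpha _ (subsetDl _ _) (subxx _)) _.
  apply/esym/(coord_le simP labx); last by move=> b _; apply: alpha_le0.
    by have [] := remove_vertexP simP labx az.
  by rewrite supp_remove.
rewrite [RHS]big_mkcond; apply: eq_bigr => a _; case: (boolP (a \in supp x z)) => az.
  have aR : a \notin supp x (remove_vertex x z a) by rewrite supp_remove // setD11.
  rewrite (bigD1 (remove_vertex x z a)) //= big1 ?addr0 => [|y /andP[ay yR]]; last first.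
    by rewrite (mub_vertex simP labx) // az [_ == y]eq_sym (negPf yR) !mulr0.
  rewrite (mub_vertex simP labx) // az eqxx mulr1 -(orient_sign_remove az).
  have [Rz Rs] := remove_vertexP simP labx az.
  have -> : (rank (remove_vertex x z a))%:Z == k + 1.
    rewrite (rank_supp simP labx) Rs; apply/eqP; move: zl; rewrite (cardsD1 a (supp x z)) az.
    by move: #|_| => u; lia.
  rewrite andbT Rs; case: ifP => [wR|wR]; first by rewrite mulrAC.
  have aS : a \in S.
    move: wR; rewrite (le_supp simP labx wz Rz) Rs wS => /negbT/subsetPn[b bS].
    have : b \in supp x z by rewrite -wS in bS; apply: (subsetP (supp_le simP labx wz)).
    by rewrite in_setD1 => ->; rewrite andbT negbK => /eqP <-.
  rewrite (@coord_neg _ _ _ _ _ _ _ _ a) ?mulr0 ?mul0r //; last by rewrite setD11.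
  by move: aS; rewrite inE lt_neqAle alpha_le0 andbT.
rewrite big1 // => y ay; rewrite (mub_vertex simP labx) // (negPf az) !mulr0 //.
Qed.

(** The coordinates on a set F not containing supp alpha are 0 for degree reasons;
    if F contains supp alpha, each face with support F lies above some w. *)
Lemma cech_restrict_inj i k (c c' : cech AP i) :
    k + 1 = i -> cech_homog alpha c -> cech_homog alpha c' ->
    (forall w, supp x w = S -> cech_restrict w k c = cech_restrict w k c') ->
  c = c'.
Proof.
move=> ki /cech_degP cD /cech_degP cD' cc; apply: cech_ext => F Fi.
have [SF|/subsetPn[a aS aF]] := boolP (S \subset F); last first.
  have a0 : alpha a < 0 by move: aS; rewrite inE lt_neqAle alpha_le0 andbT.
  by rewrite (loc_deg_eq0 simP labx (cD F) a0) ?(loc_deg_eq0 simP labx (cD' F) a0).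
apply: (coord_inj simP labx (cD F) (cD' F)) => v; rewrite (setUidPl SF) => vF.
subst F; have [w wv wS] := face_of_supp simP labx SF.
have vQ : (v \notin contrastar w) && ((rank v)%:Z == k + 1).
  by rewrite inE negbK wv (rank_supp simP labx) Fi ki eqxx.
have /ffunP/(_ (exist _ v vQ)) := cc w wS; rewrite !ffunE /=.
by move/(congr1 (fun t => orient_sign v * t)); rewrite !mulrA orient_signK !mul1r.
Qed.

(** A face lies above at most one w with support supp alpha, so the values
    prescribed by the various b w do not conflict. *)
Lemma cech_restrict_surj i
    (b : forall w : support_face x S, cochain K (contrastar (val w)) (i - 1)) :
  exists2 c : cech AP i, cech_homog alpha c
    & forall w, cech_restrict (val w) (i - 1) c = b w.
Proof.
pose Q F (z : locF F) := loc_homog alpha z /\ forall v (w : support_face x S),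
  supp x v = F -> (val w <= v)%O ->
  coord v alpha z = orient_sign v * oapp (b w) 0 (insub v).
have [F|c cP] := @cech_exists _ _ _ _ x i Q.
  have [SF|/subsetPn[a aS aF]] := boolP (S \subset F); last first.
    exists 0; split=> [|v w vF wv]; first exact: loc_deg0.
    case/negP: aF; rewrite -vF; apply: (subsetP (supp_le simP labx wv)).
    by rewrite (eqP (valP w)).
  have [|z zD zE] := @coord_exists K d P n x simP labx F alpha (fun v => orient_sign v *
      if [pick w : support_face x S | (val w <= v)%O] is Some w
      then oapp (b w) 0 (insub v) else 0).
    move=> a; apply: contraR => a0; apply: (subsetP SF).
    by rewrite inE; move: a0; case: eqP => // ->.
  exists z; split=> // v w vF wv; rewrite zE ?(setUidPl SF) //.
  case: pickP => [w' w'v|/(_ w)]; last by rewrite wv.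
  suff -> : w' = w by [].
  apply/val_inj/(supp_inj simP labx w'v wv).
  by rewrite (eqP (valP w)) (eqP (valP w')).
exists c.
  apply/cech_degP => F; have [Fi|Fi] := eqVneq #|F|%:Z i; first by have [] := cP F Fi.
  by rewrite cech_at_out //; apply: loc_deg0.
move=> w; apply/ffunP => y; rewrite ffunE.
have /andP[] := valP y; rewrite inE negbK (rank_supp simP labx) => wy /eqP yi1.
have yi := etrans yi1 (subrK 1 i).
have [_ /(_ _ w erefl wy) ->] := cP _ yi.
by rewrite mulrA orient_signK mul1r valK.
Qed.

End NonpositiveDegree.

End Comparison.

(** * The isomorphisms and the module structure *)
Section Main.
Variables (K : fieldType) (d : Order.disp_t) (P : finBPOrderType d).
Variables (n : nat) (x : 'I_n -> P).
Hypothesis simP : simplicial_poset P.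
Hypothesis labx : vertex_labeling x.

Local Notation AP := (@Defs_face_module__canonical__GRing_Lmodule K d P n x).
Local Notation locF F := (loc AP (xprod K F)).
Local Notation loc_incl F G :=
  (@loc_map _ AP (xprod K F) (xprod K G) (xprod K (G :\: F))).
Local Notation loc_homog := (loc_deg (face_deg x)).
Local Notation cech_homog := (cech_deg (face_deg x)).
Implicit Types (F G : {set 'I_n}) (alpha beta : {ffun 'I_n -> int}).


Variable O : rel 'I_n.
Hypothesis orO : orientation x O.


Local Notation loc_coh i := (face_cohomology K x i).

Lemma unit_degreeE (j : 'I_n) : unit_degree j = intdeg U_(j)%MM.
Proof. by apply/ffunP => k; rewrite !ffunE mnm1E eq_sym. Qed.

Lemma cech_homogX i alpha (j : 'I_n) (c : cech AP i) : cech_homog alpha c ->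
  cech_homog (alpha + unit_degree j) ('X_j *: c).
Proof.
move=> /cech_degP cD; apply/cech_degP => F; rewrite cech_atZ unit_degreeE.
exact: (loc_degX simP labx).
Qed.

Lemma cech_homog_d i k alpha (c : cech AP i) : i + 1 = k -> cech_homog alpha c ->
  cech_homog alpha (cech_d c : cech AP k).
Proof.
move=> ik /cech_degP cD; apply/cech_degP => G.
have [Gk|Gk] := eqVneq #|G|%:Z k; last by rewrite cech_at_out //; apply: loc_deg0.
rewrite cech_dE //; apply: (big_ind (loc_homog alpha)) => [|u v|a aG].
- exact: loc_deg0.
- exact: loc_degD.
- by rewrite sign_mpolyC; apply: loc_degZ; apply: loc_deg_map; rewrite ?subsetDl.
Qed.

Lemma face_cohomologyP i (h : loc_coh i) : exists2 c : cech AP i,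
  cech_d c = 0 :> cech AP (i + 1) &
  h = coclass (@cech_d K n AP (i - 1) i) (@cech_d K n AP i (i + 1)) c.
Proof. by have [h0 hE] := representativeP h; exists (representative h). Qed.

Lemma face_cohomology_deg_pos i alpha (j : 'I_n) (h : loc_coh i) : 0 < alpha j ->
  face_cohomology_deg alpha h -> h = 0.
Proof.
move=> aj [c cD [dc ->]]; have [b bE] := cech_homog_exact simP labx aj cD dc.
by apply/(coclass_eq0 _ dc); exists b.
Qed.

Lemma face_cohomology_degX i alpha (j : 'I_n) (h : loc_coh i) :
  face_cohomology_deg alpha h ->
  face_cohomology_deg (alpha + unit_degree j) ('X_j *: h : loc_coh i).
Proof.
move=> [c cD [dc ->]]; exists ('X_j *: c); first exact: cech_homogX.
by split; [rewrite linearZ /= dc scaler0 | rewrite coclassZ].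
Qed.

(** The representative of h need not be homogeneous: [cech_restrict] is a chain map
    on the whole Cech complex, and it only retains the part of degree alpha. *)
Definition comparison i alpha (h : loc_coh i) :
    contrastar_sum K x O (degree_supp alpha) (i - 1) :=
  fun w => coclass _ _ (cech_restrict O alpha (val w) (i - 1) (representative h)).

Arguments comparison {i} alpha h.

Section Comparison.
Variables (i : int) (alpha : {ffun 'I_n -> int}).
Hypothesis alpha0 : nonpositive alpha.
Implicit Types (w : support_face x (degree_supp alpha)) (c : cech AP i).

Let ii : i - 1 + 1 = i. Proof. exact: subrK. Qed.

Lemma cech_restrict_cocycle c w : cech_d c = 0 :> cech AP (i + 1) ->
  coboundary x O (i - 1 + 1) (cech_restrict O alpha (val w) (i - 1) c) = 0.
Proof.
move=> dc.
have wS : supp x (val w) = degree_supp alpha by apply/eqP/(valP w).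
rewrite (cech_restrict_d (j := i + 1) simP labx orO alpha0 _ wS) ?ii //.
by rewrite dc; apply/ffunP => y; rewrite !ffunE cech_at0 coord0 // mulr0.
Qed.

Lemma cech_restrictB w k c c' : cech_restrict O alpha (val w) k (c - c') =
  cech_restrict O alpha (val w) k c - cech_restrict O alpha (val w) k c'.
Proof.
have -> : c - c' = (-1)%:MP *: c' + c by rewrite mpolyCN scaleN1r addrC.
by rewrite cech_restrict_linear // scaleN1r addrC.
Qed.

Lemma comparison_class c : cech_d c = 0 :> cech AP (i + 1) ->
  comparison alpha (coclass _ _ c : loc_coh i) =
  fun w => coclass _ _ (cech_restrict O alpha (val w) (i - 1) c).
Proof.
move=> dc; apply/functional_extensionality_dep => w; rewrite /comparison.
have [gr rE] := representativeP
  (coclass (@cech_d K n AP (i - 1) i) (@cech_d K n AP i (i + 1)) c).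
have [b bE] := (coclass_eq _ gr dc).1 rE.
apply/coclass_eq; [exact: cech_restrict_cocycle|exact: cech_restrict_cocycle|].
exists (cech_restrict O alpha (val w) (i - 1 - 1) b).
have wS : supp x (val w) = degree_supp alpha by apply/eqP/(valP w).
rewrite /= (cech_restrict_d (j := i) simP labx orO alpha0 _ wS) ?subrK //.
by rewrite bE cech_restrictB.
Qed.

(** Homogeneous Cech cochains of degree alpha correspond to families of relative
    cochains by [cech_restrict_inj] and [cech_restrict_surj], and this
    correspondence commutes with the differentials; so cocycles and coboundaries
    correspond. *)
Lemma comparison_iso :
  restricts_to_iso (@face_cohomology_deg K d P n x i alpha) (@comparison i alpha).
Proof.
split.
- move=> a h h' _ _.
  have [[c dc ->] [c' dc' ->]] := (face_cohomologyP h, face_cohomologyP h').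
  rewrite -coclassP // !comparison_class //; last by rewrite linearP /= dc dc' scaler0 addr0.
  apply/functional_extensionality_dep => w.
  by rewrite cech_restrict_linear // coclassP //; apply: cech_restrict_cocycle.
- move=> h [c cD [dc ->]]; rewrite comparison_class // => c0.
  have bex w : exists b : cochain K (contrastar (val w)) (i - 1 - 1),
      coboundary x O (i - 1) b = cech_restrict O alpha (val w) (i - 1) c.
    have c0w : coclass _ _ (cech_restrict O alpha (val w) (i - 1) c) = 0 :=
      congr1 (fun u : contrastar_sum K x O (degree_supp alpha) (i - 1) => u w) c0.
    exact/(coclass_eq0 _ (cech_restrict_cocycle w dc)).
  pose b w := sval (cid (bex w)).
  have bE w : coboundary x O (i - 1) (b w) = cech_restrict O alpha (val w) (i - 1) c.
    exact: (svalP (cid (bex w))).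
  (* The cochains b w bounding on each summand assemble into one Cech cochain. *)
  have [e eD eE] := cech_restrict_surj simP labx O b.
  apply/(coclass_eq0 _ dc); exists e.
  have eD' : cech_homog alpha (cech_d e : cech AP i) by apply: cech_homog_d eD; exact: ii.
  apply: (cech_restrict_inj simP labx (O := O) alpha0 ii eD' cD) => w wS.
  have wS' : supp x w == degree_supp alpha by apply/eqP.
  rewrite -(bE (exist _ w wS')) -eE.
  by rewrite (@cech_restrict_d K d P n x simP labx O orO alpha alpha0 w (i - 1) i) ?subrK.
- move=> u.
  have [c cD cE] := cech_restrict_surj simP labx O (fun w => representative (u w)).
  have dc : cech_d c = 0 :> cech AP (i + 1).
    have cD' : cech_homog alpha (cech_d c : cech AP (i + 1)) by apply: cech_homog_d cD.
    apply: (cech_restrict_inj simP labx (O := O) (k := i - 1 + 1) alpha0 _ cD').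
    - by rewrite ii.
    - by apply/cech_degP => F; rewrite cech_at0; apply: loc_deg0.
    move=> w wS; have wS' : supp x w == degree_supp alpha by apply/eqP.
    have ii1 : i - 1 + 1 + 1 = i + 1 by rewrite ii.
    rewrite -(cech_restrict_d simP labx orO alpha0 c wS erefl ii ii1).
    have := cE (exist _ w wS'); rewrite /= => ->.
    have [du _] := representativeP (u (exist _ w wS')); apply: (etrans du).
    by apply/ffunP => y; rewrite !ffunE cech_at0 coord0 // mulr0.
  exists (coclass _ _ c); first by exists c.
  rewrite comparison_class //; apply/functional_extensionality_dep => w.
  by rewrite cE; have [] := representativeP (u w).
Qed.

End Comparison.
Lemma contrastar_ideal (w y z : P) : z \in contrastar w -> (y <= z)%O -> y \in contrastar w.
Proof. by rewrite !inE => + yz; apply: contra => wy; apply: le_trans yz. Qed.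

Lemma cochain_inclusion_d (Q Q' : {set P}) i k (b : cochain K Q i) :
    (forall y z, z \in Q -> (y <= z)%O -> y \in Q) -> Q' \subset Q ->
  coboundary x O k (cochain_inclusion Q' b) = cochain_inclusion Q' (coboundary x O k b).
Proof.
move=> Qideal sQ.
have valE y : oapp (cochain_inclusion Q' b) 0 (insub y) = oapp b 0 (insub y).
  case: insubP => [z _ <-|ny]; first by rewrite /= ffunE.
  rewrite insubN //; apply: contra ny => /andP[yQ ->]; rewrite andbT.
  by apply: contra yQ; apply: (subsetP sQ).
apply/ffunP => z; rewrite coboundaryE ffunE.
under eq_bigr do rewrite /= valE.
case: insubP => [z' _ zz'|zQ] /=; first by rewrite coboundaryE zz'.
have {}zQ : val z \in Q.
  by move: zQ; have /andP[_ ->] := valP z; rewrite andbT negbK.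
rewrite big1 // => y _; case: insubP => [y' /andP[yQ _] _|_]; last by rewrite mul0r.
rewrite big1 ?mulr0 // => a _; case: (boolP (_ \in _)) => [|_]; last by rewrite mulr0.
by rewrite inE => /andP[/andP[_ yz] _]; rewrite (Qideal _ _ zQ yz) in yQ.
Qed.

Section VertexAction.
Variables (i : int) (alpha : {ffun 'I_n -> int}) (j : 'I_n).
Hypothesis alpha0 : nonpositive alpha.
Hypothesis aj : alpha j < 0.
Let gamma := alpha + unit_degree j.

Lemma nonpositive_add_unit : nonpositive gamma.
Proof.
apply/forallP => k; rewrite !ffunE; have := forallP alpha0 k.
case: eqP => [->|_] /=; last by rewrite addr0.
by move: aj; move: (alpha j) => t; lia.
Qed.

(** Restricted to y, the variable x_j is 0 unless x_j is a vertex of y. *)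
Lemma coord_vertex (c : cech AP i) y :
  coord y gamma (cech_at ('X_j *: c) (supp x y)) =
  if j \in supp x y then coord y alpha (cech_at c (supp x y)) else 0.
Proof.
rewrite cech_atZ /gamma unit_degreeE coordX //.
by rewrite -mesym1_set1 msup_mesym1 sub1set.
Qed.

Lemma scale_face_class c : cech_d c = 0 :> cech AP (i + 1) ->
  'X_j *: (coclass _ _ c : loc_coh i) =
  coclass (@cech_d K n AP (i - 1) i) (@cech_d K n AP i (i + 1)) ('X_j *: c) :> loc_coh i.
Proof. by move=> dc; apply/esym/coclassZ. Qed.

Lemma comparison_vertex c : cech_d c = 0 :> cech AP (i + 1) ->
  comparison gamma ('X_j *: (coclass _ _ c : loc_coh i) : loc_coh i) =
  fun w => coclass _ _ (cech_restrict O gamma (val w) (i - 1) ('X_j *: c)).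
Proof.
move=> dc.
have dX : cech_d ('X_j *: c) = 0 :> cech AP (i + 1) by rewrite linearZ /= dc scaler0.
have E1 := congr1 (@comparison i gamma) (scale_face_class dc).
have E2 := comparison_class nonpositive_add_unit dX.
by apply: (etrans E1); apply: E2.
Qed.

(** Every face above w contains x_j, so the cochains themselves agree. *)
Lemma comparison_vertex_eq (h : loc_coh i) (w : P) (wa : supp x w == degree_supp alpha)
    (wg : supp x w == degree_supp gamma) :
  comparison gamma ('X_j *: h) (exist _ w wg) = comparison alpha h (exist _ w wa).
Proof.
have [c dc ->] := face_cohomologyP h.
apply: etrans (congr1 (@^~ (exist _ w wg)) (comparison_vertex dc)) _.
apply: etrans _ (esym (congr1 (@^~ (exist _ w wa)) (comparison_class alpha0 dc))).
congr (coclass _ _ _); apply/ffunP => y; rewrite !ffunE coord_vertex.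
rewrite (_ : j \in supp x (val y)) //.
have /andP[] := valP y; rewrite inE negbK => wy _.
by apply: (subsetP (supp_le simP labx wy)); rewrite (eqP wa) inE lt_eqF.
Qed.

(** The faces above z that contain x_j are distributed among the faces w obtained
    from z by adding x_j, and those that do not contain x_j carry the value 0. *)
Lemma comparison_vertex_remove (h : loc_coh i) : alpha j = -1 ->
  comparison gamma ('X_j *: h) = remove_vertex_map j (comparison alpha h).
Proof.
move=> aj1; have [c dc ->] := face_cohomologyP h.
apply: etrans (comparison_vertex dc) _.
apply/functional_extensionality_dep => z; rewrite /remove_vertex_map.
have suppE : degree_supp gamma = degree_supp alpha :\ j.
  apply/setP => k; rewrite !inE !ffunE; case: (eqVneq k j) => [->|_] /=; last by rewrite addr0.
  by rewrite aj1.
have sz : supp x (val z) = degree_supp alpha :\ j by rewrite (eqP (valP z)).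
have ja : j \in degree_supp alpha by rewrite inE aj1.
have cost_sub (w : support_face x (degree_supp alpha)) :
    remove_vertex x (val w) j == val z -> contrastar (val z) \subset contrastar (val w).
  move=> /eqP wz; have [|zw _] := remove_vertexP simP labx (w := val w) (j := j).
    by rewrite (eqP (valP w)).
  by apply/subsetP => v; rewrite !inE; apply: contra; apply: le_trans; rewrite -wz.
transitivity (\sum_(w : support_face x (degree_supp alpha)
                      | remove_vertex x (val w) j == val z)
   coclass (@coboundary K d P n x O (contrastar (val z)) (i - 1 - 1) (i - 1))
           (@coboundary K d P n x O (contrastar (val z)) (i - 1) (i - 1 + 1))
      (cochain_inclusion (contrastar (val z)) (cech_restrict O alpha (val w) (i - 1) c))).
  rewrite -coclass_sum => [|w wz].
    congr (coclass _ _ _); apply/ffunP => y.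
    rewrite ffunE coord_vertex sum_ffunE.
    have /andP[] := valP y; rewrite inE negbK => zy yi.
    transitivity (\sum_(w : support_face x (degree_supp alpha)
                          | remove_vertex x (val w) j == val z)
        if (val w <= val y)%O then orient_sign K x O (val y) *
           coord (val y) alpha (cech_at c (supp x (val y))) else 0); last first.
      by apply: eq_bigr => w wz; rewrite ffunE cech_restrict_val yi andbT.
    case: ifP => jy; last first.
      rewrite mulr0 big1 // => w _; case: ifP => // wy; case/negP: jy.
      by apply: (subsetP (supp_le simP labx wy)); rewrite (eqP (valP w)).
    have sub : degree_supp alpha \subset supp x (val y).
      rewrite -(setD1K ja) subUset sub1set jy -sz.
      exact: (supp_le simP labx zy).
    have [w wy ws] := face_of_supp simP labx sub.
    have wS : supp x w == degree_supp alpha by apply/eqP.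
    have wz : remove_vertex x w j = val z.
      have [|rw rs] := remove_vertexP simP labx (w := w) (j := j); first by rewrite ws.
      apply: (supp_inj simP labx (le_trans rw wy) zy).
      by rewrite rs ws sz.
    rewrite (bigD1 (exist _ w wS)) /=; last exact/eqP.
    rewrite wy big1 ?addr0 // => v /andP[vz vw]; case: ifP => // vy.
    case/eqP: vw; apply/val_inj/(supp_inj simP labx vy wy).
    by rewrite (eqP (valP v)).
  rewrite /= cochain_inclusion_d; [|exact: contrastar_ideal|exact: cost_sub].
  rewrite cech_restrict_cocycle //.
  by apply/ffunP => y; rewrite !ffunE; case: insub => //= v; rewrite ffunE.
apply: eq_bigr => w wz.
have E : comparison alpha (coclass _ _ c : loc_coh i) w =
    coclass _ _ (cech_restrict O alpha (val w) (i - 1) c).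
  exact: (congr1 (@^~ w) (comparison_class alpha0 dc)).
apply: etrans _ (esym (congr1 (@pair_map K d P n x O _ _ (i - 1)) E)).
exact: (esym (pair_map_class (@contrastar_ideal _) (cost_sub w wz)
  (cech_restrict_cocycle alpha0 w dc))).
Qed.

End VertexAction.

End Main.

Theorem theorem4p4 (K : fieldType) (d : Order.disp_t) (P : finBPOrderType d)
    (n : nat) (x : 'I_n -> P) (O : rel 'I_n) :
    (forall s : seq K, exists a, a \notin s) ->
    simplicial_poset P -> vertex_labeling x -> orientation x O ->
  (forall (i : int) (alpha : {ffun 'I_n -> int}), ~~ nonpositive alpha ->
    forall h : face_cohomology K x i, face_cohomology_deg alpha h -> h = 0) /\
  (exists phi : forall (i : int) (alpha : {ffun 'I_n -> int}),
      face_cohomology K x i -> contrastar_sum K x O (degree_supp alpha) (i - 1),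
    (forall (i : int) (alpha : {ffun 'I_n -> int}), nonpositive alpha ->
      restricts_to_iso (@face_cohomology_deg K d P n x i alpha) (phi i alpha)) /\
    (forall (i : int) (alpha : {ffun 'I_n -> int}) (j : 'I_n)
        (h : face_cohomology K x i),
      nonpositive alpha -> face_cohomology_deg alpha h ->
      let gamma := alpha + unit_degree j in
      [/\ alpha j < -1 ->
            forall (w : P) (wa : supp x w == degree_supp alpha)
              (wg : supp x w == degree_supp gamma),
            phi i gamma ('X_j *: h) (exist _ w wg) = phi i alpha h (exist _ w wa),
          alpha j = -1 ->
            phi i gamma ('X_j *: h) = remove_vertex_map j (phi i alpha h)
        & 0 <= alpha j -> 'X_j *: h = 0])).
Proof.
move=> _ simP labx orO; split=> [i alpha|].
  move=> /forallPn[j]; rewrite -ltNge => aj h.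
  exact: (face_cohomology_deg_pos simP labx aj).
exists (fun i => @comparison K d P n x O i).
split=> [i alpha alpha0|i alpha j h alpha0 hD gamma].
  exact: comparison_iso.
split=> [aj w wa wg|aj|aj].
- by apply: comparison_vertex_eq => //; apply: lt_trans aj _.
- by apply: comparison_vertex_remove => //; rewrite aj.
apply: (face_cohomology_deg_pos simP labx (alpha := gamma) (j := j)).
  by rewrite !ffunE eqxx; move: aj; move: (alpha j) => t; lia.
exact: (face_cohomology_degX simP labx).
Qed.
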